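(* Let $D>3$ be an integer, and suppose that there exist constants $c_D>0$ and $\nu_D>\frac12+\frac{1}{D-1}$ such that the number of number fields $L\subset\overline{\mathbb{Q}}$ of degree $D$ with $|\Delta_L|\leq T$ is at least $c_D T^{\nu_D}$ for all $T$ large enough. Then there exists a real number $\gamma>\frac{1}{2D(D-1)}$ such that there are infinitely many number fields $L\subset\overline{\mathbb{Q}}$ of degree $D$ with $$\delta(L)>|\Delta_L|^{\gamma}.$$
   Context: Fix an algebraic closure $\overline{\mathbb{Q}}$ of $\mathbb{Q}$; every number field is regarded as a subfield of $\overline{\mathbb{Q}}$. $H(\cdot)$ denotes the absolute multiplicative Weil height on $\overline{\mathbb{Q}}$, i.e. $H(\alpha)=\prod_v \max\{1,|\alpha|_v\}^{[K_v:\mathbb{Q}_v]/[K:\mathbb{Q}]}$ for any number field $K$ containing $\alpha$, with $v$ running over the places of $K$ and $|\cdot|_v$ extending the standard absolute values on $\mathbb{Q}$. For a number field $L$, $\Delta_L$ is its (absolute) discriminant, and $\delta(L)=\inf\{H(\alpha) : L=\mathbb{Q}(\alpha)\}$ is the smallest height of a generator of $L$ over $\mathbb{Q}$ (the infimum is attained). *)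

(* Defs.v *)
From HB Require Import structures.
From mathcomp Require Import all_boot all_order all_algebra all_field.
From mathcomp Require Import all_classical all_reals all_analysis.

Set Implicit Arguments.
Unset Strict Implicit.
Unset Printing Implicit Defensive.

Import Order.TTheory GRing.Theory Num.Theory.
Import numFieldNormedType.Exports.

Local Open Scope classical_set_scope.
Local Open Scope ring_scope.

(* Abstract number fields are [fieldExtType rat]; a number field inside the
   algebraic closure [algC] of Q is the image of such a K under an embedding
   (see [subfields_algC] at the end). *)

Definition padic_abs (R : realType) (p : nat) (q : rat) : R :=
  if q == 0 then 0
  else p%:R ^+ logn p `|denq q|%N / p%:R ^+ logn p `|numq q|%N.

Definition standard_abs (R : realType) (a : rat -> R) : Prop :=
  (forall q, a q = `|ratr q|) \/
  (exists2 p : nat, prime p & forall q, a q = padic_abs R p q).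

(* A place of K is identified with its unique representative that extends a
   standard absolute value of Q; distinct functions are distinct places. *)
Definition place (R : realType) (K : fieldExtType rat) (v : K -> R) : Prop :=
  [/\ forall x, 0 <= v x,
      forall x, v x = 0 <-> x = 0,
      forall x y, v (x * y) = v x * v y,
      forall x y, v (x + y) <= v x + v y &
      standard_abs (fun q : rat => v q%:A)].

Section Completion.
Variables (R : realType) (K : fieldExtType rat) (v : K -> R).

Definition null_seq (u : nat -> K) : Prop := (fun k => v (u k)) @ \oo --> (0 : R).

Definition cauchy_seq (u : nat -> K) : Prop :=
  forall e : R, 0 < e -> exists N : nat,
    forall m n : nat, (N <= m)%N -> (N <= n)%N -> v (u m - u n) < e.

(* The completion K_v is the ring of v-Cauchy sequences in K modulo null
   sequences, and Q_v is the image in it of the v-Cauchy sequences of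
   rationals.  The classes of b_0, ..., b_(n-1) form a basis of K_v over Q_v. *)
Definition completion_basis (n : nat) (b : 'I_n -> nat -> K) : Prop :=
  let cauchy_rat (q : nat -> rat) := cauchy_seq (fun k => (q k)%:A) in
  [/\ forall i, cauchy_seq (b i),
      forall u, cauchy_seq u ->
        exists2 q : 'I_n -> nat -> rat, forall i, cauchy_rat (q i) &
          null_seq (fun k => u k - \sum_(i < n) q i k *: b i k) &
      forall q : 'I_n -> nat -> rat, (forall i, cauchy_rat (q i)) ->
        null_seq (fun k => \sum_(i < n) q i k *: b i k) ->
        forall i, null_seq (fun k => (q i k)%:A)].

(* [K_v : Q_v] *)
Definition local_degree : nat :=
  xget 0%N [set n | exists b : 'I_n -> nat -> K, completion_basis b].

End Completion.

(* The absolute height does not depend on the number field containing x in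
   which it is computed.  Only finitely many factors differ from 1. *)
Definition height (R : realType) (K : fieldExtType rat) (x : K) : R :=
  \big[*%R/1]_(v \in [set v : K -> R | place v])
    (Num.max 1 (v x) `^ ((local_degree v)%:R / (\dim {:K})%:R)).

(* delta(K) *)
Definition min_generator_height (R : realType) (K : fieldExtType rat) : R :=
  inf [set height R x | x in [set x : K | <<1; x>>%VS = {:K}%VS]].

(* The trace from K to Q, i.e. the trace of multiplication by x on K. *)
Definition field_trace (K : fieldExtType rat) (x : K) : rat :=
  \sum_(i < \dim {:K}) coord (vbasis {:K}) i (x * (vbasis {:K})`_i).

Definition integral_basis (K : fieldExtType rat) (b : 'I_(\dim {:K}) -> K) :
    Prop :=
  free [seq b i | i : 'I_(\dim {:K})] /\
  forall x : K, integralOver (intr : int -> K) x <->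
    exists c : 'I_(\dim {:K}) -> int, x = \sum_i b i *~ c i.

Definition discriminant (K : fieldExtType rat) : rat :=
  xget 0 [set d | exists2 b : 'I_(\dim {:K}) -> K, integral_basis b &
                    d = \det (\matrix_(i, j) field_trace (b i * b j))].

Definition abs_discriminant (R : realType) (K : fieldExtType rat) : R :=
  `|ratr (discriminant K)|.

(* The number fields L inside algC of degree D that have the property P, where
   P is an isomorphism invariant of number fields. *)
Definition subfields_algC (D : nat) (P : fieldExtType rat -> Prop) :
    set (set algC) :=
  [set L | exists (K : fieldExtType rat) (iota : {rmorphism K -> algC}),
             [/\ range iota = L, \dim {:K} = D & P K]].

(* Main.v *)
Require Import Defs.
From HB Require Import structures.
From mathcomp Require Import all_boot all_order all_algebra all_field.
From mathcomp Require Import all_classical all_reals all_analysis.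
From mathcomp Require Import complex finmap.
From mathcomp Require Import ring lra zify.

Set Implicit Arguments.
Unset Strict Implicit.
Unset Printing Implicit Defensive.

Import Order.TTheory GRing.Theory Num.Theory.
Import numFieldNormedType.Exports.

Local Open Scope classical_set_scope.
Local Open Scope card_scope.
Local Open Scope ring_scope.

(** The statement is a counting argument.  Suppose that, for some gamma, all but
    finitely many fields L of degree D satisfy delta(L) <= |Delta_L| ^ gamma.
    Then all but finitely many of those with |Delta_L| <= T have a generator x
    with H(x) <= 2 T ^ gamma, and the primitive minimal polynomial of x has
    integer coefficients bounded by 2 ^ D H(x) ^ D.  As this polynomial and one
    of its roots determine L, there are O(T ^ (gamma D (D + 1))) such fields, so
    nu <= gamma D (D + 1).  The assumption on nu says exactly that
    1 / (2 D (D - 1)) < nu / (D (D + 1)), and any gamma strictly between these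
    two numbers gives a contradiction.

    The work lies in the bound for the coefficients
    ([coef_minpoly_le_height]), the height being a product over all places with
    exponents defined through completions.  For each standard absolute value s
    of Q take an algebraically closed field with an absolute value extending s:
    the complex numbers at infinity, the algebraic numbers at a prime
    ([exists_padic_absolute_value], by Chevalley's extension argument).  The D
    embeddings of K in it induce places of K.  Expanding the product of the
    'X - r over the conjugates r of x bounds the s-size of the coefficients of
    the monic minimal polynomial by the product of the max(1, |r|).  At the
    primes this product is at least the exact power of p in the leading
    coefficient of the primitive polynomial; multiplying over all s yields the
    bound, provided that each place v is induced by at most [K_v : Q_v] of the
    embeddings.

    This last fact ([embeddings_leq_local_degree]) is an effective form of
    Dedekind's independence of characters: if there were more embeddings than
    basis elements of K_v, a combination of them would kill the basis, and then
    be small on the powers of x, against the invertibility of a Vandermonde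
    matrix.  For the local degree to be meaningful a basis of K_v has to exist
    ([exists_completion_basis]), and for the product defining the height to be
    the expected one only finitely many places may be large at x
    ([finite_large_places], by weak approximation). *)

(** * Absolute values *)

Definition absolute_value (R : realType) (F : fieldType) (w : F -> R) : Prop :=
  [/\ forall x, 0 <= w x, forall x, w x = 0 <-> x = 0,
      forall x y, w (x * y) = w x * w y &
      forall x y, w (x + y) <= w x + w y].

Section AbsoluteValues.
Variables (R : realType) (F : fieldType) (w : F -> R).
Hypothesis wP : absolute_value w.

Lemma absv_ge0 x : 0 <= w x. Proof. by case: wP. Qed.

Lemma absvM x y : w (x * y) = w x * w y. Proof. by case: wP. Qed.

Lemma absvD x y : w (x + y) <= w x + w y. Proof. by case: wP. Qed.

Lemma absv0 : w 0 = 0. Proof. by case: wP => _ w0 _ _; apply/w0. Qed.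

Lemma absv_eq0 x : (w x == 0) = (x == 0).
Proof. by case: wP => _ w0 _ _; apply/eqP/eqP => /w0. Qed.

Lemma absv_gt0 x : (0 < w x) = (x != 0).
Proof. by rewrite lt_def absv_ge0 absv_eq0 andbT. Qed.

Lemma absv1 : w 1 = 1.
Proof.
have w1 : w 1 != 0 by rewrite absv_eq0 oner_eq0.
by apply: (mulfI w1); rewrite -absvM !mulr1.
Qed.

Lemma absvN x : w (- x) = w x.
Proof.
have /eqP : w (-1) ^+ 2 = 1 by rewrite expr2 -absvM mulrNN mulr1 absv1.
rewrite sqrf_eq1 => /orP[] /eqP wN1; first by rewrite -mulN1r absvM wN1 mul1r.
by have := absv_ge0 (-1); rewrite wN1 ler0N1.
Qed.

Lemma absvB x y : w (x - y) <= w x + w y.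
Proof. by rewrite (le_trans (absvD _ _)) ?absvN. Qed.

Lemma absvX x n : w (x ^+ n) = w x ^+ n.
Proof.
by elim: n => [|n IHn]; rewrite ?expr0 ?absv1 // !exprS absvM IHn.
Qed.

Lemma absvV x : w x^-1 = (w x)^-1.
Proof.
have [->|x0] := eqVneq x 0; first by rewrite invr0 absv0 invr0.
have wx : w x != 0 by rewrite absv_eq0.
by apply: (mulfI wx); rewrite -absvM !divff // absv1.
Qed.

Lemma absv_sum (I : Type) (r : seq I) (P : pred I) (G : I -> F) :
  w (\sum_(i <- r | P i) G i) <= \sum_(i <- r | P i) w (G i).
Proof.
elim/big_rec2: _ => [|i y z _ le_zy]; first by rewrite absv0.
by rewrite (le_trans (absvD _ _)) // lerD2l.
Qed.

End AbsoluteValues.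

Lemma absolute_value_comp (R : realType) (F L : fieldType) (w : L -> R)
    (f : {rmorphism F -> L}) :
  absolute_value w -> absolute_value (fun y => w (f y)).
Proof.
move=> wP; split=> [y|y|y z|y z].
- exact: absv_ge0.
- split=> [/eqP|->]; last by rewrite rmorph0 (absv0 wP).
  by rewrite (absv_eq0 wP) fmorph_eq0 => /eqP.
- by rewrite rmorphM (absvM wP).
- by rewrite rmorphD (absvD wP).
Qed.

(** Applied to the powers of an absolute value, this removes the constants lost
    when the triangle inequality is used for many terms. *)
Lemma le1_linear_growth (R : realType) (C t : R) :
  (forall n, t ^+ n <= C * n.+1%:R) -> t <= 1.
Proof.
move=> t_le; rewrite leNgt; apply/negP => t_gt1.
pose s := Num.sqrt t.
have s_gt1 : 1 < s by rewrite -sqrtr1 ltr_sqrt // (lt_trans ltr01).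
(* Bernoulli for the square root of t makes the powers of t grow
   quadratically *)
have bern n : n%:R * (s - 1) + 1 <= s ^+ n.
  elim: n => [|n IHn]; first by rewrite mul0r add0r expr0.
  rewrite exprS; have sn : 1 <= s ^+ n by rewrite exprn_ege1 ?ltW.
  rewrite -natr1; nra.
have s1 : 0 < s - 1 by rewrite subr_gt0.
have C0 : 0 <= C by have := t_le 0%N; rewrite expr0 mulr1; lra.
have [n n_gt] : exists n : nat, 2 * C * (s - 1) ^-2 < n.+1%:R.
  by exists (Num.truncn (2 * C * (s - 1) ^-2)); exact: truncnS_gt.
have := t_le n.+1.
have -> : t = s ^+ 2 by rewrite sqr_sqrtr // (le_trans ler01) // ltW.
rewrite -exprM mulnC exprM -natr1.
have := bern n.+1.
have : 2 * C < n.+1%:R * (s - 1) ^+ 2.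
  by rewrite -(ltr_pdivrMr _ _ (exprn_gt0 2 s1)).
have : 1 <= n.+1%:R :> R by rewrite ler1n.
set N := n.+1%:R; set u := s - 1 in s1 *; set S := s ^+ _.
move=> N1 Nu uS S2.
have : (N * u + 1) ^+ 2 <= S ^+ 2 by rewrite lerXn2r ?nnegrE; nra.
rewrite !expr2 in Nu S2 * => NuS.
have : (N * u) * (N * u) <= 2 * C * N by nra.
have : 0 < N by lra.
move=> N0; rewrite mulrACA -mulrA [2 * C * N]mulrC ler_pM2l //; lra.
Qed.

(** * Valuation rings above a prime *)

Section MaximalSubring.
Variables (F : numFieldType) (p : nat).
Hypothesis p_prime : prime p.

Definition subring (A : set F) : Prop :=
  [/\ A 1, forall x y, A x -> A y -> A (x - y) &
      forall x y, A x -> A y -> A (x * y)].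

Definition avoiding_subring (A : set F) : Prop := subring A /\ ~ A p%:R^-1.

Let p0 : p%:R != 0 :> F.
Proof. by rewrite pnatr_eq0 -lt0n prime_gt0. Qed.

Section SubringTheory.
Variable A : set F.
Hypothesis AP : subring A.

Lemma subring1 : A 1. Proof. by case: AP. Qed.

Lemma subringB x y : A x -> A y -> A (x - y).
Proof. by case: AP => _ + _; apply. Qed.

Lemma subringM x y : A x -> A y -> A (x * y).
Proof. by case: AP => _ _; apply. Qed.

Lemma subring0 : A 0.
Proof. by rewrite -(subrr 1); apply: subringB; apply: subring1. Qed.

Lemma subringN x : A x -> A (- x).
Proof.
by move=> Ax; rewrite -sub0r; apply: subringB => //; apply: subring0.
Qed.

Lemma subringD x y : A x -> A y -> A (x + y).
Proof. by move=> Ax Ay; rewrite -(opprK y); apply/subringB/subringN. Qed.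

Lemma subringX x n : A x -> A (x ^+ n).
Proof.
by move=> Ax; elim: n => [|n IHn]; rewrite ?exprS;
  [apply: subring1 | apply: subringM].
Qed.

Lemma subring_nat n : A n%:R.
Proof.
elim: n => [|n IHn]; first exact: subring0.
by rewrite -natr1; apply: subringD => //; apply: subring1.
Qed.

Lemma subring_int n : A n%:~R.
Proof.
case: n => n; first exact: subring_nat.
by rewrite NegzE mulrNz; apply/subringN/subring_nat.
Qed.

Lemma subring_sum (I : Type) (r : seq I) (P : pred I) (G : I -> F) :
  (forall i, P i -> A (G i)) -> A (\sum_(i <- r | P i) G i).
Proof.
by move=> AG; elim/big_ind: _ => //; [apply: subring0 | apply: subringD].
Qed.

Definition adjoin (z : F) : set F :=
  [set y | exists2 g : {poly F}, (forall i, A g`_i) & g.[z] = y].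

Lemma subring_adjoin z : subring (adjoin z).
Proof.
split.
- exists 1; last by rewrite hornerC.
  by move=> i; rewrite coef1; apply: subring_nat.
- move=> _ _ [g Ag <-] [h Ah <-]; exists (g - h);
    last by rewrite hornerD hornerN.
  by move=> i; rewrite coefB; apply: subringB.
- move=> _ _ [g Ag <-] [h Ah <-]; exists (g * h); last by rewrite hornerM.
  by move=> i; rewrite coefM; apply: subring_sum => j _; apply: subringM.
Qed.

Lemma sub_adjoin z : A `<=` adjoin z.
Proof.
move=> x Ax; exists x%:P; last by rewrite hornerC.
by move=> i; rewrite coefC; case: ifP => // _; apply: subring0.
Qed.

Lemma mem_adjoin z : adjoin z z.
Proof.
by exists 'X; rewrite ?hornerX // => i; rewrite coefX; apply: subring_nat.
Qed.

End SubringTheory.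

(** The image of the integers is one such ring, and the union of a chain of them
    is another.  The empty set is let in so that the empty chain has an upper
    bound. *)
Lemma exists_maximal_avoiding_subring :
  exists2 V, avoiding_subring V &
    forall B, avoiding_subring B -> V `<=` B -> B = V.
Proof.
pose Pr A := A = set0 \/ avoiding_subring A.
have [F0 FP totF|V [PV maxV]] := @Zorn_bigcup F Pr.
  have [E|/existsNP[X /not_implyP[F0X X0]]] :=
    pselect (forall X, F0 X -> X = set0).
    by left; rewrite bigcup0.
  have avF Y : F0 Y -> Y !=set0 -> avoiding_subring Y.
    by move=> FY /set0P/eqP Y0; case: (FP _ FY).
  have avX : avoiding_subring X by case: (FP _ F0X).
  have upper x y : (\bigcup_(Y in F0) Y) x -> (\bigcup_(Y in F0) Y) y ->
      exists Y, [/\ F0 Y, avoiding_subring Y, Y x & Y y].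
    move=> [Y FY Yx] [Z FZ Zy]; have [sYZ|sZY] := totF _ _ FY FZ.
      by exists Z; split=> //; [apply: avF => //; exists y | apply: sYZ].
    by exists Y; split=> //; [apply: avF => //; exists x | apply: sZY].
  right; split; first split.
  - by exists X => //; case: avX => /subring1.
  - move=> x y Ux Uy; have [Y [FY [Y1 _] Yx Yy]] := upper _ _ Ux Uy.
    by exists Y => //; apply: subringB.
  - move=> x y Ux Uy; have [Y [FY [Y1 _] Yx Yy]] := upper _ _ Ux Uy.
    by exists Y => //; apply: subringM.
  - by move=> [Y FY Yp]; have [] := avF _ FY (ex_intro _ _ Yp).
have avZ : avoiding_subring (range (intr : int -> F)).
  split; first split.
  - by exists 1.
  - by move=> _ _ [m _ <-] [n _ <-]; exists (m - n) => //; rewrite rmorphB.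
  - by move=> _ _ [m _ <-] [n _ <-]; exists (m * n) => //; rewrite rmorphM.
  case=> n _ /(congr1 ( *%R p%:R));
    rewrite divff // -[p%:R]/(p%:Z%:~R) -rmorphM /=.
  move/eqP; rewrite -[1]/(1%:~R) eqr_int => /eqP pn1.
  have := congr1 absz pn1; rewrite abszM /= => /eqP;
    rewrite muln_eq1 => /andP[/eqP p1 _].
  by move: p_prime; rewrite p1.
case: PV => [V0|avV].
  exfalso; apply: (maxV (range (intr : int -> F))); last by right.
  by rewrite V0; split=> // /(_ 1); apply; exists 1.
exists V => // B avB sVB; apply/seteqP; split=> //.
apply: contrapT => nBV; apply: (maxV B); last by right.
by split.
Qed.

Variable V : set F.
Hypotheses (Vav : avoiding_subring V)
  (Vmax : forall B, avoiding_subring B -> V `<=` B -> B = V).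

Let Vring : subring V. Proof. by case: Vav. Qed.

Lemma maximal_adjoin z : ~ V z -> adjoin V z p%:R^-1.
Proof.
move=> nVz; apply: contrapT => nVp; apply: nVz.
have <- : adjoin V z = V.
  by apply: Vmax => //; [split=> //; apply: subring_adjoin | apply: sub_adjoin].
exact: mem_adjoin.
Qed.

Lemma maximal_1sub c : V c -> 1 - p%:R * c != 0.
Proof.
move=> Vc; rewrite subr_eq0; apply/eqP => pc1; case: Vav => _; apply.
by rewrite (_ : p%:R^-1 = c) //; apply: (mulfI p0); rewrite divff.
Qed.

(** Otherwise, by maximality, the inverse of p is a polynomial in the inverse of
    u = 1 - pc; clearing denominators puts u ^ n / p in V, and u ^ n is 1
    modulo p. *)
Lemma maximal_unit c : V c -> V (1 - p%:R * c)^-1.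
Proof.
move=> Vc; have := maximal_1sub Vc; set u := 1 - _ => u0.
have Vu : V u.
  apply: subringB => //; first exact: subring1.
  by apply: subringM => //; apply: subring_nat.
apply: contrapT => /maximal_adjoin[g Vg gu]; case: Vav => _; apply.
have VunP : V (u ^+ size g / p%:R).
  rewrite -gu horner_coef mulr_sumr; apply: subring_sum => // i _.
  rewrite mulrCA; apply: subringM => //.
  rewrite exprVn -expfB ?ltn_ord //; apply: subringX => //.
have [c' Vc' uE] : exists2 c', V c' & u ^+ size g = 1 - p%:R * c'.
  elim: (size g) => [|n [c' Vc' IHn]].
    by exists 0; rewrite ?mulr0 ?subr0 //; apply: subring0.
  exists (c + c' * u); first by apply: subringD => //; apply: subringM.
  by rewrite exprSr IHn /u; ring.
rewrite -[p%:R^-1](subrK c'); apply: subringD => //.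
by move: VunP; rewrite uE mulrBl mul1r mulrAC divff // mul1r.
Qed.

(** The relation 1 = p g(z) with g over V of degree at most n, which witnesses
    that p becomes invertible in V[z]. *)
Definition unit_relation (z : F) (n : nat) : Prop :=
  exists2 c : nat -> F, forall i, V (c i) &
    1 = p%:R * \sum_(i < n.+1) c i * z ^+ i.

Lemma unit_relation0 z : ~ unit_relation z 0.
Proof.
case=> c Vc; rewrite big_ord1 expr0 mulr1 => E.
by have := maximal_1sub (Vc 0%N); rewrite -E subrr eqxx.
Qed.

Lemma unit_relation_reduce z n m : z != 0 -> (m <= n.+1)%N ->
  unit_relation z n.+1 -> unit_relation z^-1 m -> unit_relation z n.
Proof.
move=> z0 le_mn [c Vc cE] [d Vd dE].
set u := 1 - p%:R * d 0%N.
have u0 : u != 0 by apply: maximal_1sub.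
have Vu : V u^-1 by apply: maximal_unit.
(* the relation for the inverse of z expresses the top power of z *)
have zE : z ^+ n.+1 = p%:R * \sum_(j < m) d j.+1 / u * z ^+ (n - j).
  have uE : u = p%:R * \sum_(j < m) d j.+1 * z^-1 ^+ j.+1.
    rewrite /u {1}dE big_ord_recl expr0 mulr1 mulrDr addrC addKr.
    by congr (_ * _); apply: eq_bigr => j _.
  apply: (mulfI u0); rewrite {1}uE -mulrA [in RHS]mulrCA; congr (_ * _).
  rewrite mulr_suml mulr_sumr; apply: eq_bigr => j _.
  have jn : (j.+1 <= n.+1)%N by rewrite (leq_trans (ltn_ord j)).
  rewrite -[n in LHS](subnK (jn : (j <= n)%N)) -addnS exprD exprVn.
  by field; rewrite u0 expf_neq0.
pose e i :=
  c i + (if (n < i + m)%N then p%:R * c n.+1 * (d (n - i).+1 / u) else 0).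
exists e.
  move=> i; apply: subringD => //; case: ifP => _; last exact: subring0.
  by do ![apply: subringM => //]; apply: subring_nat.
rewrite {1}cE big_ord_recr /= zE; congr (_ * _).
under [RHS]eq_bigr do rewrite mulrDl; rewrite big_split /=; congr (_ + _).
rewrite mulrA [c _ * _]mulrC mulr_sumr.
under [RHS]eq_bigr do rewrite (fun_if (fun x => x * _)) mul0r.
rewrite -big_mkcond /= [RHS](reindex_inj rev_ord_inj) /=.
rewrite (big_ord_widen_cond n.+1 xpredT
          (fun j => _ * (d j.+1 / u * z ^+ (n - j)))) //.
apply: eq_big => [j|j _]; have := ltn_ord j; first by lia.
by move=> jn; rewrite subSS subKn // !mulrA.
Qed.

Lemma no_two_unit_relations z n m : z != 0 ->
  unit_relation z n -> unit_relation z^-1 m -> False.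
Proof.
move: {2}(n + m)%N (leqnn (n + m)) => s; elim: s z n m => [|s IHs] z n m.
  by rewrite leqn0 addn_eq0 => /andP[/eqP-> _] _ /unit_relation0.
move=> nms z0 zn zm; have [le_mn|lt_nm] := leqP m n.
  case: n nms zn le_mn => [_ /unit_relation0 //|n nms zn le_mn].
  by apply: (IHs z n m) => //; apply: unit_relation_reduce le_mn zn zm.
case: m nms zm lt_nm => [//|m nms zm lt_nm].
apply: (IHs z^-1 m n); rewrite ?invr_eq0 ?invrK //;
  first by rewrite addnC -ltnS -addnS.
by apply: (@unit_relation_reduce _ _ n _ _ zm);
  rewrite ?invr_eq0 ?invrK // ltnW.
Qed.

(** Chevalley: if neither z nor its inverse were in V, maximality would give
    relations 1 = p g(z) and 1 = p h(1/z) over V, and each of them lowers the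
    degree of the other. *)
Lemma maximal_valuation_ring z : V z \/ V z^-1.
Proof.
have [->|z0] := eqVneq z 0; first by left; apply: subring0.
have rel y : ~ V y -> exists n, unit_relation y n.
  move=> /maximal_adjoin[g Vg gy]; exists (size g), (fun i => g`_i) => //.
  rewrite -(@horner_coef_wide _ (size g).+1) ?gy ?divff //.
have [|/rel[n zn]] := pselect (V z); first by left.
have [|/rel[m zm]] := pselect (V z^-1); first by right.
by case: (no_two_unit_relations z0 zn zm).
Qed.

(** By Bezout a multiple of m is 1 modulo p, hence a unit of V. *)
Lemma maximal_coprime_inv m : coprime p m -> V m%:R^-1.
Proof.
move=> pm; have p_gt0 := prime_gt0 p_prime.
have [km kp E _] := egcdnP m p_gt0; rewrite (eqP pm) in E.
have m0 : m%:R != 0 :> F.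
  rewrite pnatr_eq0; apply: contraTneq pm => ->.
  by rewrite /coprime gcdn0 neq_ltn prime_gt1 ?orbT.
(* km * p = kp * m + 1, so - kp * m = 1 - p * km is a unit of V *)
have Vu := maximal_unit (subring_nat Vring km).
have := maximal_1sub (subring_nat Vring km).
have uE : 1 - p%:R * km%:R = - (kp%:R * m%:R) :> F.
  have := congr1 (fun k => k%:R : F) E; rewrite !(natrM, natrD) => E'.
  by rewrite mulrC E'; ring.
move: Vu; rewrite uE oppr_eq0 mulf_eq0 negb_or => Vu /andP[kp0 _].
have -> : m%:R^-1 = - kp%:R * (- (kp%:R * m%:R))^-1 :> F by field; apply/andP.
by apply: subringM => //; apply: subringN => //; apply: subring_nat.
Qed.

End MaximalSubring.

(** * Extending the p-adic absolute value *)

Section ValuationOfRing.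
Variables (R : realType) (F : numFieldType) (p : nat) (V : set F).
Hypotheses (p_prime : prime p) (Vring : subring V) (VpV : ~ V p%:R^-1)
  (Vval : forall z, V z \/ V z^-1)
  (Vcop : forall m, coprime p m -> V m%:R^-1)
  (Varch : forall z, exists N, V (p%:R ^+ N * z)).

Let p0 : p%:R != 0 :> F.
Proof. by rewrite pnatr_eq0 -lt0n prime_gt0. Qed.

Let pR0 : p%:R != 0 :> R.
Proof. by rewrite pnatr_eq0 -lt0n prime_gt0. Qed.

Let p_gt0 : 0 < p%:R :> R. Proof. by rewrite ltr0n prime_gt0. Qed.

Let p_gt1 : 1 < p%:R :> R. Proof. by rewrite ltr1n prime_gt1. Qed.

(** An element of V has size at most 1, so z ^ b * p ^ k in V should mean that
    the size of z is at most p ^ (k / b).  The absolute value is the infimum of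
    these rational powers of p. *)
Definition size_bounds (z : F) : set R :=
  [set r | 0 < r /\ exists (b : nat) (k : int),
     r ^+ b.+1 = p%:R ^ k /\ V (z ^+ b.+1 * p%:R ^ k)].

Definition ring_abs (z : F) : R := inf (size_bounds z).

Lemma size_bounds_neq0 z : size_bounds z !=set0.
Proof.
have [N VN] := Varch z; exists (p%:R ^ N); split; first exact: exprz_gt0.
by exists 0%N, N; rewrite !expr1 mulrC.
Qed.

Lemma size_bounds_inf z : has_inf (size_bounds z).
Proof. by split; [exact: size_bounds_neq0 | exists 0 => r [/ltW]]. Qed.

Lemma ring_abs_ge0 z : 0 <= ring_abs z.
Proof. by apply: lb_le_inf; [exact: size_bounds_neq0 | move=> r [/ltW]]. Qed.

Lemma ring_abs_le z r : size_bounds z r -> ring_abs z <= r.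
Proof. by apply: ge_inf; case: (size_bounds_inf z). Qed.

Lemma ring_absX_le z b k :
  V (z ^+ b.+1 * p%:R ^ k) -> ring_abs z ^+ b.+1 <= p%:R ^ k.
Proof.
move=> Vz; pose r : R := (p%:R ^ k) `^ b.+1%:R^-1.
have pk : 0 < p%:R ^ k :> R by exact: exprz_gt0.
have rE : r ^+ b.+1 = p%:R ^ k.
  by rewrite -powR_mulrn ?powR_ge0 // -powRrM mulVf ?pnatr_eq0 // powRr1 // ltW.
rewrite -rE lerXn2r ?nnegrE ?ring_abs_ge0 ?powR_ge0 //.
by apply: ring_abs_le; split; [exact: powR_gt0 | exists b, k].
Qed.

Lemma ring_abs_leP z (k : int) : V (z * p%:R ^ k) -> ring_abs z <= p%:R ^ k.
Proof. by move=> Vz; rewrite -[ring_abs z]expr1; apply: ring_absX_le. Qed.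

Lemma ring_abs_le1 z : V z -> ring_abs z <= 1.
Proof.
move=> Vz; rewrite -(expr0z p%:R).
by apply: ring_abs_leP; rewrite expr0z mulr1.
Qed.

Lemma ring_absM_le z y : ring_abs (z * y) <= ring_abs z * ring_abs y.
Proof.
have SM r s : size_bounds z r -> size_bounds y s -> ring_abs (z * y) <= r * s.
  move=> [r0 [b [k [rE Vz]]]] [s0 [c [l [sE Vy]]]]; apply: ring_abs_le.
  split; first exact: mulr_gt0.
  exists (b.+1 * c.+1).-1, (k * c.+1%:Z + l * b.+1%:Z);
    rewrite prednK ?muln_gt0 //.
  rewrite !exprMn !expfzDr // -!exprz_exp -!exprnP.
  rewrite {2 4}[(b.+1 * c.+1)%N]mulnC !exprM rE sE; split=> //.
  by rewrite mulrACA -!exprMn; apply: subringM => //; apply: subringX.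
have SM' r : size_bounds z r -> ring_abs (z * y) <= r * ring_abs y.
  move=> Sr; have r0 : 0 < r by case: Sr.
  rewrite -ler_pdivrMl //; apply: lb_le_inf; first exact: size_bounds_neq0.
  by move=> s Ss; rewrite ler_pdivrMl //; apply: SM.
have := ring_abs_ge0 y; rewrite le_eqVlt => /orP[/eqP y0|y0].
  have [r Sr] := size_bounds_neq0 z.
  by rewrite (le_trans (SM' _ Sr)) // -y0 !mulr0.
rewrite -ler_pdivrMr //; apply: lb_le_inf; first exact: size_bounds_neq0.
by move=> r Sr; rewrite ler_pdivrMr //; apply: SM'.
Qed.

Lemma ring_abs1 : ring_abs 1 = 1.
Proof.
apply/eqP; rewrite eq_le; apply/andP; split; first by apply: ring_abs_le1;
  apply: subring1.
apply: lb_le_inf => [|r [r0 [b [k [rE]]]]]; first exact: size_bounds_neq0.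
rewrite expr1n mul1r; case: k rE => k rE Vk.
  rewrite -(@ler_pXn2r _ b.+1) ?nnegrE ?(ltW r0) // expr1n rE.
  by rewrite -exprnP exprn_ege1 // ltW.
case: VpV; rewrite NegzE in Vk.
have -> : p%:R^-1 = p%:R ^+ k * p%:R ^ (- k.+1%:Z) :> F.
  by rewrite -exprnN exprS; field; rewrite p0 expf_neq0.
by apply: subringM => //; apply: subringX => //; apply: subring_nat.
Qed.

(** The least k with z ^ b * p ^ k in V pins down the size of z up to a factor
    p ^ (1 / b), which tends to 1. *)
Lemma ring_absMV z : z != 0 -> ring_abs z * ring_abs z^-1 <= 1.
Proof.
move=> z0; apply: (@le1_linear_growth _ p%:R) => -[|b].
  by rewrite expr0 mulr1 ltW.
pose y := z ^+ b.+1; have y0 : y != 0 by rewrite expf_neq0.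
have [N VN] := Varch y^-1; have [M VM] := Varch y.
pose P m := `[< V (y * p%:R ^ (m%:Z - N.+1%:Z)) >].
have exP : exists m, P m.
  exists (M + N.+1)%N; apply/asboolP; rewrite PoszD addrK -exprnP mulrC //.
have P0 : ~~ P 0%N.
  apply/asboolPn => V0; apply: VpV; have := subringM Vring V0 VN.
  congr V; rewrite sub0r -exprnN exprS; field.
  by rewrite p0 y0 expf_neq0.
case: (ex_minnP exP) => -[|m] /asboolP Pm minm; first by case/negP: P0;
  apply/asboolP.
have Vinv : V (z^-1 ^+ b.+1 * p%:R ^ (N.+1%:Z - m%:Z)).
  have [Vm|] := Vval (y * p%:R ^ (m%:Z - N.+1%:Z)).
    by have := minm m; rewrite ltnn => /(_ (introT (asboolP _) Vm)).
  by rewrite invfM invr_expz opprB exprVn.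
have le1 := ring_absX_le Pm; have le2 := ring_absX_le Vinv.
rewrite exprMn (le_trans (ler_pM _ _ le1 le2)) ?exprn_ge0 ?ring_abs_ge0 //.
rewrite -expfzDr // (_ : _ + _ = 1) ?expr1z; last by rewrite -addn1 PoszD; ring.
by rewrite ler_peMr ?(ltW p_gt0) // ler1n.
Qed.

Lemma ring_abs0 : ring_abs 0 = 0.
Proof.
have := ring_absM_le p%:R 0; rewrite mulr0.
have p1 : ring_abs p%:R <= p%:R ^ (-1).
  by apply: ring_abs_leP; rewrite exprN1 mulfV //; apply: subring1.
have : p%:R ^ (-1) < 1 :> R by rewrite exprN1 invf_lt1.
move: p1 (ring_abs_ge0 0); move: (_ ^ _) (ring_abs _) (ring_abs _) => q s t;
  nra.
Qed.

(** The size of 1 / z is at most the inverse of that of z, which reverses the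
    inequality [ring_absM_le]. *)
Lemma ring_absM z y : ring_abs (z * y) = ring_abs z * ring_abs y.
Proof.
apply/eqP; rewrite eq_le ring_absM_le /=.
have [->|z0] := eqVneq z 0.
  by rewrite !mul0r ring_abs0 mul0r.
have := ring_absM_le z^-1 (z * y); rewrite mulKf // => le_y.
have := ring_absMV z0 => le1.
rewrite (le_trans (ler_wpM2l (ring_abs_ge0 z) le_y)) // mulrA.
by rewrite ler_piMl ?ring_abs_ge0.
Qed.

(** One of the two quotients of z and y lies in V; if it is z / y, then so does
    1 + z / y, and z + y = y (1 + z / y). *)
Lemma ring_abs_max z y : ring_abs (z + y) <= Num.max (ring_abs z) (ring_abs y).
Proof.
wlog Vzy : z y / y != 0 /\ V (z / y).
  move=> W; have [->|y0] := eqVneq y 0; first by rewrite addr0 le_max lexx.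
  have [->|z0] := eqVneq z 0; first by rewrite add0r le_max lexx orbT.
  have [Vzy|Vyz] := Vval (z / y); first by apply: W; split.
  by rewrite addrC maxC; apply: (W y z); split=> //; rewrite -invf_div.
have [y0 {}Vzy] := Vzy.
have -> : z + y = y * (1 + z / y) by field.
rewrite le_max ring_absM ler_piMr ?orbT ?ring_abs_ge0 //.
by apply: ring_abs_le1; apply: subringD => //; apply: subring1.
Qed.

Lemma ring_abs_absolute_value : absolute_value ring_abs.
Proof.
split; [exact: ring_abs_ge0 | | exact: ring_absM | ].
  move=> z; split=> [z0|->]; last exact: ring_abs0.
  apply/eqP; apply: contraT => nz.
  by have := ring_absM z z^-1; rewrite z0 mul0r divff // ring_abs1 => /eqP;
    rewrite oner_eq0.
move=> z y; rewrite (le_trans (ring_abs_max z y)) //.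
by rewrite ge_max lerDl lerDr !ring_abs_ge0.
Qed.

Lemma ring_abs_nat n : (0 < n)%N -> ring_abs n%:R = (p%:R ^+ logn p n)^-1.
Proof.
have absP := ring_abs_absolute_value.
move=> n0; have [m pm nE] := pfactor_coprime p_prime n0.
rewrite {1}nE natrM natrX (absvM absP) (absvX absP).
have -> : ring_abs m%:R = 1.
  apply/eqP; rewrite eq_le ring_abs_le1 /=; last exact: subring_nat.
  rewrite -[ring_abs _]invrK -(absvV absP) invf_ge1.
    by apply: ring_abs_le1; apply: Vcop.
  rewrite (absvV absP) invr_gt0 (absv_gt0 absP).
  by rewrite pnatr_eq0; apply: contraTneq n0 => m0; rewrite nE m0.
rewrite mul1r -exprVn; congr (_ ^+ _); apply/eqP; rewrite eq_le; apply/andP;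
  split.
  by rewrite -exprN1; apply: ring_abs_leP; rewrite exprN1 mulfV //;
    apply: subring1.
rewrite -[ring_abs _]invrK -(absvV absP) lef_pV2 ?posrE //.
  by rewrite -[leRHS]expr1z; apply: ring_abs_leP; rewrite expr1z mulVf //;
    apply: subring1.
by rewrite (absvV absP) invr_gt0 absv_gt0.
Qed.

Lemma ring_abs_ratr q : ring_abs (ratr q) = padic_abs R p q.
Proof.
have absP := ring_abs_absolute_value.
have absz n : n != 0 -> ring_abs n%:~R = (p%:R ^+ logn p `|n|%N)^-1.
  move=> n0; rewrite -ring_abs_nat ?absz_gt0 // natr_absz.
  case: (ger0P n) => _ //; by rewrite rmorphN absvN.
rewrite /padic_abs; case: eqVneq => [->|q0]; first by rewrite rmorph0 absv0.
rewrite /ratr (absvM absP) (absvV absP) !absz ?denq_eq0 ?numq_eq0 //.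
by rewrite invrK mulrC.
Qed.

End ValuationOfRing.

(** The valuation ring V has rank one because every algebraic number z is
    brought into V by a power of p.  Otherwise the inverses of all p ^ N z lie
    in V; dividing an integral equation of degree n for z by z ^ n then makes
    its leading coefficient divisible in V by arbitrarily high powers of p. *)
Lemma exists_padic_absolute_value (R : realType) (p : nat) : prime p ->
  exists w : algC -> R,
    [/\ absolute_value w, forall x y, w (x + y) <= Num.max (w x) (w y) &
        forall q, w (ratr q) = padic_abs R p q].
Proof.
move=> p_prime.
have [V [Vring VpV] Vmax] := exists_maximal_avoiding_subring algC p_prime.
have Vval := maximal_valuation_ring p_prime (conj Vring VpV) Vmax.
have Vcop := maximal_coprime_inv p_prime (conj Vring VpV) Vmax.
have p0 : p%:R != 0 :> algC by rewrite pnatr_eq0 -lt0n prime_gt0.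
suff Varch z : exists N, V (p%:R ^+ N * z).
  exists (ring_abs R p V); split.
  - exact: ring_abs_absolute_value.
  - exact: ring_abs_max.
  - exact: ring_abs_ratr.
apply: contrapT => /forallNP nV.
have z0 : z != 0.
  by apply: contra_notT (nV 0%N) => /negPn/eqP ->; rewrite mulr0;
    apply: subring0.
have [g g0 gz] : exists2 g : {poly int}, g != 0 & root (map_poly intr g) z.
  have [g [_ /monic_neq0 g0] rootE] := minCpolyP z.
  have [h [a a0 hE]] := rat_poly_scale g.
  exists h; first by apply: contraNneq g0 => h0; rewrite hE h0 rmorph0 scaler0.
  have : root (map_poly ratr g : {poly algC}) z by rewrite rootE.
  rewrite hE map_polyZ rootZ ?fmorph_eq0 ?invr_eq0 ?intr_eq0 //.
  by rewrite -map_poly_comp (eq_map_poly (fun i => ratr_int _ i)).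
pose n := (size g).-1; pose c := lead_coef g.
have c0 : (0 < `|c|)%N by rewrite absz_gt0 lead_coef_eq0.
have [m pm cE] := pfactor_coprime p_prime c0.
pose e := logn p `|c|; pose t := (p%:R ^+ e.+1 * z)^-1.
have Vt : V t by case: (Vval (p%:R ^+ e.+1 * z)) => // /nV.
have m0 : m%:R != 0 :> algC.
  by rewrite pnatr_eq0; apply: contraTneq c0 => m0; rewrite cE m0.
(* dividing g(z) = 0 by z ^ n exhibits the leading coefficient as a multiple of
   a higher power of p than the one dividing it *)
have [s Vs csE] : exists2 s, V s & c%:~R = p%:R ^+ e.+1 * s :> algC.
  exists (- \sum_(i < n) (g`_i)%:~R * (t * (p%:R ^+ e.+1 * t) ^+ (n - i.+1))).
    apply: subringN => //; apply: subring_sum => // i _.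
    apply: subringM => //; first exact: subring_int.
    apply: subringM => //; apply: subringX => //; apply: subringM => //.
    by apply: subringX => //; apply: subring_nat.
  have pe0 : p%:R ^+ e.+1 != 0 :> algC by rewrite expf_neq0.
  have zE : z^-1 = p%:R ^+ e.+1 * t by rewrite /t; field; rewrite z0 pe0.
  have := gz; rewrite rootE horner_coef size_map_poly_id0; last first.
    by rewrite intr_eq0 lead_coef_eq0.
  have -> : size g = n.+1 by rewrite prednK // lt0n size_poly_eq0.
  rewrite big_ord_recr /= !coef_map /= -/c addr_eq0 => /eqP gzE.
  have zn0 : z ^+ n != 0 by rewrite expf_neq0.
  apply: (mulIf zn0); rewrite -[LHS]opprK -gzE mulrN mulNr; congr (- _).
  rewrite mulr_sumr mulr_suml; apply: eq_bigr => i _; rewrite coef_map /=.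
  rewrite -zE -[n in z ^+ n](subnK (ltn_ord i)) exprVn exprD [z ^+ i.+1]exprS.
  have {1}-> : z ^+ i = p%:R ^+ e.+1 * t * (z * z ^+ i) by rewrite -zE mulKf.
  by field; rewrite expf_neq0.
apply: VpV; have [s' Vs' csE'] : exists2 s', V s' &
    `|c|%N%:R = p%:R ^+ e.+1 * s' :> algC.
  rewrite natr_absz; case: (ger0P c) => _; first by exists s.
  by exists (- s); [apply: subringN | rewrite [LHS]rmorphN /= csE mulrN].
have -> : p%:R^-1 = s' * m%:R^-1 :> algC.
  have : p%:R ^+ e != 0 :> algC by rewrite expf_neq0.
  move: csE'; rewrite cE natrM natrX exprS -/e => E pe0.
  have {}E : m%:R = p%:R * s' by apply: (mulIf pe0); rewrite E; ring.
  by move: m0; rewrite E mulf_eq0 negb_or => /andP[_ s0]; field; rewrite p0 s0.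
by apply: subringM => //; apply: Vcop.
Qed.

(** * Bases of completions *)

Section Completion.
Variables (R : realType) (K : fieldExtType rat) (v : K -> R).
Hypothesis vP : absolute_value v.

Lemma absvZ q y : v (q *: y) = v q%:A * v y.
Proof. by rewrite -(absvM vP) mulr_algl. Qed.

Lemma absv_algV q : v (q^-1)%:A = (v q%:A)^-1.
Proof. by rewrite -(absvV vP) -[(q^-1)%:A]/(in_alg K q^-1) fmorphV. Qed.

Lemma null_seqP (u : nat -> K) :
  null_seq v u <->
  forall e, 0 < e -> exists N, forall k, (N <= k)%N -> v (u k) < e.
Proof.
split=> [/cvgrPdist_lt u0 e /u0 [N _ NP]|u0].
  exists N => k /NP /=; rewrite sub0r normrN ger0_norm //; exact: absv_ge0.
apply/cvgrPdist_lt => e /u0 [N NP]; exists N => // k /= /NP.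
by rewrite sub0r normrN ger0_norm //; exact: absv_ge0.
Qed.

(** Linear independence over the completion of the rationals. *)
Definition completion_free n (b : 'I_n -> K) : Prop :=
  forall q : 'I_n -> nat -> rat,
    (forall i, cauchy_seq v (fun k => (q i k)%:A)) ->
    null_seq v (fun k => \sum_(i < n) q i k *: b i) ->
    forall i, null_seq v (fun k => (q i k)%:A).

Lemma cauchy_seq_cst y : cauchy_seq v (fun=> y).
Proof. by move=> e e0; exists 0%N => m n _ _; rewrite subrr absv0. Qed.

Lemma completion_free_lift n (b : 'I_n.+1 -> K) i :
  completion_free b -> completion_free (b \o lift i).
Proof.
move=> bfree q qC qb.
pose q' j := if unlift i j is Some j' then q j' else fun=> 0.
move=> j; have := bfree q' _ _ (lift i j).
rewrite /q' liftK; apply.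
  by move=> k; case: unliftP => [k' _|_]; [exact: qC | exact: cauchy_seq_cst].
rewrite (_ : (fun k => _) =
  (fun k => \sum_(i0 < n) q i0 k *: (b \o lift i) i0)) //.
apply/funext => k; rewrite (bigD1_ord i) //= unlift_none scale0r add0r.
by apply: eq_bigr => l _; rewrite liftK.
Qed.

Lemma inv_succ_lt (e : R) : 0 < e ->
  exists N, forall k, (N <= k)%N -> k.+1%:R^-1 < e.
Proof.
move=> e0; exists (Num.truncn e^-1) => k Nk.
rewrite invf_plt ?posrE // (lt_le_trans (truncnS_gt _)) // ler_nat.
by rewrite ltnS.
Qed.

(** If the i-th coordinates were not bounded by the absolute value, normalising
    them to 1 would give combinations tending to 0 whose remaining coordinates
    are Cauchy by induction: a relation in the completion. *)
Lemma completion_free_bound n (b : 'I_n -> K) i : completion_free b ->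
  exists2 C : R, 0 < C &
    forall q : 'I_n -> rat, v (q i)%:A <= C * v (\sum_j q j *: b j).
Proof.
elim: n b i => [b []//|n IHn] b i bfree.
apply: contrapT => noC.
have {noC} /choice[q qP] k : exists q : 'I_n.+1 -> rat,
    k.+1%:R * v (\sum_j q j *: b j) < v (q i)%:A.
  apply: contrapT => noq; apply: noC; exists k.+1%:R => // q.
  by rewrite leNgt; apply/negP => qlt; apply: noq; exists q.
have qi0 k : q k i != 0.
  apply/eqP => qi; have := qP k; rewrite qi scale0r (absv0 vP) ltNge.
  by rewrite mulr_ge0 // (absv_ge0 vP).
pose r k j := q k (lift i j) / q k i.
pose s k := b i + \sum_j r k j *: b (lift i j).
have sE k : s k = (q k i)^-1 *: \sum_j q k j *: b j.
  rewrite (bigD1_ord i) //= scalerDr scalerA mulVf // scale1r; congr (_ + _).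
  by rewrite scaler_sumr; apply: eq_bigr => j _; rewrite scalerA mulrC.
have s_small k : v (s k) < k.+1%:R^-1.
  have vq : 0 < v (q k i)%:A by rewrite (absv_gt0 vP) scaler_eq0 oner_eq0 orbF.
  have -> : v (s k) = v (\sum_j q k j *: b j) / v (q k i)%:A.
    by rewrite sE absvZ absv_algV mulrC.
  by rewrite ltr_pdivrMr // ltr_pdivlMl.
have rC j : cauchy_seq v (fun k => (r k j)%:A).
  have [C C0 CP] := IHn _ j (completion_free_lift (i := i) bfree).
  move=> e e0; have [N NP] :=
    inv_succ_lt (divr_gt0 e0 (mulr_gt0 C0 (ltr0n R 2))).
  exists N => k l Nk Nl; rewrite -scalerBl.
  rewrite (le_lt_trans (CP (fun j => r k j - r l j))) // -ltr_pdivlMl //.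
  have -> : \sum_j0 (r k j0 - r l j0) *: (b \o lift i) j0 = s k - s l.
    rewrite opprD addrACA subrr add0r -sumrB.
    by apply: eq_bigr => j' _; rewrite scalerBl.
  rewrite (le_lt_trans (absvB vP _ _)) //.
  have := s_small k; have := s_small l; have := NP k Nk; have := NP l Nl.
  have -> : C^-1 * e = e / (C * 2%:R) + e / (C * 2%:R) by field;
    rewrite lt0r_neq0.
  by move: (e / _) k.+1%:R^-1 l.+1%:R^-1 => *; lra.
pose r' j := if unlift i j is Some j' then r^~ j' else fun=> 1.
have := bfree r' _ _ i; rewrite /r' unlift_none => r0.
have /null_seqP/(_ 1 ltr01)[N /(_ N (leqnn N))] :
    null_seq v (fun=> (1 : rat)%:A).
  apply: r0.
    by move=> j; case: unliftP => [j' _|_]; [exact: rC | exact: cauchy_seq_cst].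
  apply/null_seqP => e e0; have [N NP] := inv_succ_lt e0; exists N => k Nk.
  rewrite (bigD1_ord i) //= unlift_none scale1r.
  rewrite (lt_trans _ (NP k Nk)) // (le_lt_trans _ (s_small k)) //.
  rewrite le_eqVlt; apply/orP; left; apply/eqP; congr (v (_ + _)).
  by apply: eq_bigr => j _; rewrite liftK.
by rewrite scale1r (absv1 vP) ltxx.
Qed.

Lemma completion_free_leq n (b : 'I_n -> K) :
  completion_free b -> (n <= \dim {:K})%N.
Proof.
move=> bfree; pose X := [tuple b i | i < n].
suff : free X.
  by move/eqP => dX; rewrite -{1}(size_tuple X) -dX; exact/dimvS/subvf.
apply/freeP => k kX i.
have := bfree (fun i _ => k i) (fun i => @cauchy_seq_cst _) _ i.
have -> : (fun=> \sum_(i < n) k i *: b i) = (fun=> 0 : K) :> (nat -> K).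
  apply/funext => _; rewrite -[RHS]kX; apply: eq_bigr => j _; congr (_ *: _).
  by rewrite -tnth_nth tnth_mktuple.
have null0 : null_seq v (fun=> 0).
  by apply/null_seqP => e e0; exists 0%N => *; rewrite (absv0 vP).
move=> /(_ null0) /null_seqP ki0; apply/eqP/negPn/negP => ki.
have vk : 0 < v (k i)%:A by rewrite (absv_gt0 vP) scaler_eq0 oner_eq0 orbF.
by have [N /(_ N (leqnn N))] := ki0 _ vk; rewrite ltxx.
Qed.

(** Take a maximal independent family b.  Adding y to it creates a relation
    whose y-coordinate does not tend to 0, as otherwise b would already satisfy
    the relation; dividing by this coordinate approximates y. *)
Lemma exists_dense_completion_free : exists (n : nat) (b : 'I_n -> K),
  completion_free b /\
  forall y e, 0 < e -> exists q : 'I_n -> rat, v (y - \sum_i q i *: b i) < e.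
Proof.
pose P n := `[< exists b : 'I_n -> K, completion_free b >].
have P0 : exists n, P n.
  by exists 0%N; apply/asboolP; exists (fun=> 0) => q _ _ [].
have Pub n : P n -> (n <= \dim {:K})%N.
  by move=> /asboolP[b /completion_free_leq].
case: (ex_maxnP P0 Pub) => n /asboolP[b bfree] nmax; exists n, b;
  split=> // y e e0.
pose b' j := if unlift ord0 j is Some j' then b j' else y.
have sumE (q : 'I_n.+1 -> rat) : \sum_j q j *: b' j =
    q ord0 *: y + \sum_j q (lift ord0 j) *: b j.
  rewrite (bigD1_ord ord0) //= /b' unlift_none; congr (_ + _).
  by apply: eq_bigr => j _; rewrite liftK.
have /existsNP[q /not_implyP[qC /not_implyP[qb qN]]] : ~ completion_free b'.
  by move=> b'free; have /nmax := introT (asboolP _) (ex_intro _ b' b'free);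
    rewrite ltnn.
have {}qb :
    null_seq v (fun k => q ord0 k *: y + \sum_j q (lift ord0 j) k *: b j).
  apply/null_seqP => d /((null_seqP _).1 qb)[N NP].
  by exists N => k /NP; rewrite (sumE (q^~ k)).
have {qN} q0N : ~ null_seq v (fun k => (q ord0 k)%:A).
  move=> q0; apply: qN => i; case: (unliftP ord0 i) => [j ->|-> //].
  apply: (bfree (fun j => q (lift ord0 j))) => [j'|]; first exact: qC.
  apply/null_seqP => d d0;
    have vy : 0 < v y + 1 by rewrite ltr_wpDl ?(absv_ge0 vP).
  have [N1 N1P] := (null_seqP _).1 qb _ (divr_gt0 d0 (ltr0n R 2)).
  have d' : 0 < d / 2%:R / (v y + 1) by rewrite !divr_gt0.
  have [N2 N2P] := (null_seqP _).1 q0 _ d'.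
  exists (maxn N1 N2) => k; rewrite geq_max => /andP[/N1P lt1 /N2P lt2].
  set S := \sum_(i0 < n) _ in lt1 *.
  have -> : S = (q ord0 k *: y + S) - q ord0 k *: y by rewrite addrC addKr.
  rewrite (le_lt_trans (absvB vP _ _)) // absvZ.
  have : v (q ord0 k)%:A * v y <= v (q ord0 k)%:A * (v y + 1).
    by rewrite ler_wpM2l ?(absv_ge0 vP) // lerDl.
  by move: lt2; rewrite ltr_pdivlMr //; lra.
have [d d0 [N NP]] : exists2 d : R, 0 < d &
    exists N, forall k, (N <= k)%N -> d <= v (q ord0 k)%:A.
  move: q0N => /null_seqP /existsNP[d /not_implyP[d0 /forallNP dN]].
  have [N NP] := qC ord0 _ (divr_gt0 d0 (ltr0n R 2)).
  exists (d / 2%:R); first exact: divr_gt0.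
  exists N => k Nk; have /existsNP[l /not_implyP[Nl /negP]] := dN N.
  rewrite -leNgt => dl; have := NP _ _ Nl Nk.
  have := absvD vP ((q ord0 l)%:A - (q ord0 k)%:A) (q ord0 k)%:A; rewrite subrK.
  lra.
have [M MP] := (null_seqP _).1 qb _ (mulr_gt0 e0 d0).
pose k := maxn N M; have := NP k (leq_maxl _ _); have := MP k (leq_maxr _ _).
set S := \sum_(i < n) _; set q0 := q ord0 k => lt_ed le_d.
have q00 : q0 != 0.
  by apply: contraTneq le_d => ->; rewrite scale0r (absv0 vP) -ltNge.
exists (fun j => - (q (lift ord0 j) k / q0)).
have -> : \sum_j - (q (lift ord0 j) k / q0) *: b j = - (q0^-1 *: S).
  by rewrite /S scaler_sumr -sumrN; apply: eq_bigr => j _;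
    rewrite scalerA mulrC scaleNr.
rewrite opprK -(ltr_pM2r d0) (le_lt_trans _ lt_ed) //.
rewrite (le_trans (ler_wpM2l (absv_ge0 vP _) le_d)) // mulrC -absvZ.
by rewrite scalerDr scalerA mulfV // scale1r.
Qed.

(** A Cauchy sequence is approximated by combinations of the dense independent
    family, whose coordinates are Cauchy by [completion_free_bound]. *)
Lemma exists_completion_basis :
  exists n (b : 'I_n -> nat -> K), completion_basis v b.
Proof.
have [n [b [bfree dense]]] := exists_dense_completion_free.
exists n, (fun i _ => b i); split=> [i|u uC|q]; first exact: cauchy_seq_cst.
  have /choice[q qP] k : exists q : 'I_n -> rat,
      v (u k - \sum_i q i *: b i) < k.+1%:R^-1.
    by apply: dense; rewrite invr_gt0.
  exists (fun i k => q k i); last first.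
    apply/null_seqP => e e0; have [N NP] := inv_succ_lt e0; exists N => k Nk.
    exact: lt_trans (NP k Nk).
  move=> i e e0; have [C C0 CP] := completion_free_bound i bfree.
  have e3 : 0 < e / (C * 3%:R) by rewrite divr_gt0 // mulr_gt0.
  have [N1 N1P] := uC _ e3; have [N2 N2P] := inv_succ_lt e3.
  exists (maxn N1 N2) => k l; rewrite !geq_max => /andP[k1 k2] /andP[l1 l2].
  rewrite -scalerBl (le_lt_trans (CP (fun i =>
    q k i - q l i))) // -ltr_pdivlMl //.
  under eq_bigr do rewrite scalerBl; rewrite sumrB.
  set Sk := \sum_(i0 < n) _; set Sl := \sum_(i0 < n) _.
  have -> : Sk - Sl = (u k - u l) - (u k - Sk) + (u l - Sl) by ring.
  rewrite (le_lt_trans (absvD vP _ _)) //.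
  have := absvB vP (u k - u l) (u k - Sk).
  have := qP k; have := qP l; rewrite -/Sk -/Sl.
  have := N1P _ _ k1 l1; have := N2P _ k2; have := N2P _ l2.
  have -> : C^-1 * e = e / (C * 3%:R) + e / (C * 3%:R) + e / (C * 3%:R).
    by field; rewrite lt0r_neq0.
  by move: (e / _) k.+1%:R^-1 l.+1%:R^-1 => *; lra.
exact: bfree.
Qed.

Lemma local_degreeP :
  exists b : 'I_(local_degree v) -> nat -> K, completion_basis v b.
Proof.
exact: (@xgetPex _ 0%N [set n | exists b, completion_basis v b])
  exists_completion_basis.
Qed.

End Completion.

(** * Weak approximation and finiteness of places *)

Section Eventually.
Variable R : realType.

Lemma expr_near_small (t e : R) : 0 <= t -> t < 1 -> 0 < e ->
  \forall r \near \oo, t ^+ r < e.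
Proof.
move=> t0 t1 e0; have /cvgrPdist_lt/(_ e e0) : (fun r =>
  t ^+ r) @ \oo --> (0 : R).
  by apply: cvg_expr; rewrite ger0_norm.
by apply: filterS => r; rewrite sub0r normrN ger0_norm // exprn_ge0.
Qed.

Lemma near_all_seq (T : eqType) (s : seq T) (P : T -> nat -> Prop) :
  {in s, forall x, \forall r \near \oo, P x r} ->
  \forall r \near \oo, {in s, forall x, P x r}.
Proof.
elim: s => [_|x s IHs sP]; first by near=> r.
have Px := sP x (mem_head x s).
have : \forall r \near \oo, {in s, forall x, P x r}.
  by apply: IHs => y ys; apply: sP; rewrite inE ys orbT.
by apply: filterS2 Px => r Px Ps y; rewrite inE => /predU1P[->|/Ps].
Unshelve. all: by end_near. Qed.

Lemma expr_unbounded (t C : R) : 1 < t -> exists n, C < t ^+ n.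
Proof.
move=> t1; apply: contrapT => /forallNP noN; move: t1; rewrite ltNge => /negP;
  apply.
apply: (@le1_linear_growth _ (Num.max C 0)) => n.
have : t ^+ n <= C by rewrite leNgt; apply/negP.
move=> /le_trans; apply; rewrite (@le_trans _ _ (Num.max C 0)) ?le_max ?lexx //.
by rewrite ler_peMr ?ler1n // le_max lexx orbT.
Qed.

Lemma exprz_between (t c : R) : 0 < t -> 1 < c ->
  exists m : int, t < c ^ m /\ c ^ m <= t * c.
Proof.
move=> t0 c1; have c0 : 0 < c by rewrite (lt_trans ltr01).
have c0' : c != 0 by rewrite lt0r_neq0.
have [N NP] := expr_unbounded t^-1 c1; have [M MP] := expr_unbounded t c1.
have NP' : c ^ (- N%:Z) <= t.
  by rewrite -exprnN -[leRHS]invrK lef_pV2 ?posrE ?invr_gt0 ?exprn_gt0 // ltW.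
pose P k := t < c ^ (k%:Z - N%:Z).
have exP : exists k, P k by exists (M + N)%N; rewrite /P PoszD addrK.
case: (ex_minnP exP) => -[|k] Pk mink.
  by move: Pk; rewrite /P sub0r ltNge NP'.
exists (k.+1%:Z - N%:Z); split=> //.
rewrite -addn1 PoszD addrAC expfzDr // expr1z ler_pM2r // leNgt.
by apply/negP => /mink; rewrite ltnn.
Qed.

End Eventually.

Section Extensions.
Variables (R : realType) (K : fieldExtType rat) (a : rat -> R).

Definition extends_abs (v : K -> R) : Prop :=
  absolute_value v /\ forall q : rat, v q%:A = a q.

Variable pi_ : rat.
Hypothesis api : 1 < a pi_.

(** Some y has v y < w y.  The quotient of the two sizes of y ^ n grows without
    bound, so a rational number of size between them can be divided out. *)
Lemma extensions_separated v w : extends_abs v -> extends_abs w -> v != w ->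
  exists z, v z < 1 /\ 1 < w z.
Proof.
move=> [vP va] [wP wa] vw.
suff sep (v' w' : K -> R) y : extends_abs v' -> extends_abs w' -> v' y < w' y ->
    exists z, v' z < 1 /\ 1 < w' z.
  have [y vwy] : exists y, v y != w y.
    by apply: contrapT => /forallNP E; case/eqP: vw; apply/funext => y;
      apply/eqP/negPn/negP/E.
  case: (ltgtP (v y) (w y)) vwy => // [lt_vw _|lt_wv _];
    first exact: (sep v w y).
  have y0 : y != 0 by apply: contraTneq lt_wv => ->; rewrite !absv0 ?ltxx.
  apply: (sep v w y^-1) => //; rewrite (absvV vP) (absvV wP).
  by rewrite ltf_pV2 // posrE ?(absv_gt0 vP) ?(absv_gt0 wP).
move=> {}[{}vP {}va] {}[{}wP {}wa] lt_vw.
have y0 : y != 0 by apply: contraTneq lt_vw => ->; rewrite !absv0 ?ltxx.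
have vy : 0 < v' y by rewrite (absv_gt0 vP).
have [n nP] : exists n, a pi_ < (w' y / v' y) ^+ n.
  by apply: expr_unbounded; rewrite ltr_pdivlMr // mul1r.
have [m [vm mw]] := exprz_between (exprn_gt0 n vy) api.
have aX (u : K -> R) : extends_abs u -> u (pi_ ^ m)%:A = a pi_ ^ m.
  move=> [uP ua]; rewrite -ua; case: m {vm mw} => m.
    by rewrite -!exprnP -[_%:A]/(in_alg K _) rmorphXn absvX.
  rewrite NegzE -!exprnN -(absvX uP) -(absvV uP); congr u.
  by rewrite -[LHS]/(in_alg K _) fmorphV rmorphXn.
have pm : 0 < a pi_ ^ m by rewrite exprz_gt0 // (lt_trans ltr01).
exists (y ^+ n / (pi_ ^ m)%:A).
rewrite (absvM vP) (absvV vP) (absvX vP) (absvM wP) (absvV wP) (absvX wP) !aX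
  //.
rewrite ltr_pdivrMr // ltr_pdivlMr // !mul1r; split=> //.
rewrite (le_lt_trans mw) // mulrC -ltr_pdivlMr ?exprn_gt0 //.
by rewrite -exprVn -exprMn.
Qed.

(** The induction step of Artin and Whaples: correct the element z found for
    the previous absolute values by an element y separating v0 from the new
    one. *)
Lemma extension_dominates (v0 : K -> R) (vs : seq (K -> R)) : extends_abs v0 ->
  {in vs, forall v, extends_abs v /\ v != v0} ->
  exists z, 1 < v0 z /\ {in vs, forall v, v z < 1}.
Proof.
move=> v0P; have [v0a v0E] := v0P.
elim: vs => [_|u vs IHvs vsP]; first by exists pi_%:A; rewrite v0E.
have [uP uv0] := vsP u (mem_head u vs); have [ua uE] := uP.
have vsP' : {in vs, forall v, extends_abs v /\ v != v0}.
  by move=> v vvs; apply: vsP; rewrite inE vvs orbT.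
have [z [z0 zvs]] := IHvs vsP'.
have [y [uy v0y]] := extensions_separated uP v0P uv0.
have vy1 (v : K -> R) : absolute_value v -> 0 < v y + 1.
  by move=> va; rewrite ltr_wpDl ?(absv_ge0 va).
have small :
    \forall r \near \oo, {in vs, forall v : K -> R, v z ^+ r * (v y + 1) < 1}.
  apply: near_all_seq => v vvs; have [[va _] _] := vsP' v vvs.
  have : \forall r \near \oo, v z ^+ r < (v y + 1)^-1.
    by apply: expr_near_small; rewrite ?(absv_ge0 va) ?zvs // invr_gt0 vy1.
  by apply: filterS => r; rewrite -[X in _ < X]mul1r ltr_pdivlMr ?vy1.
have [uz|uz] := leP (u z) 1.
  have /filter_ex[r rP] := small.
  exists (z ^+ r * y); split.
    rewrite (absvM v0a) (absvX v0a) (lt_le_trans v0y) //.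
    by rewrite ler_peMl ?(absv_ge0 v0a) // exprn_ege1 // ltW.
  move=> v; rewrite inE => /predU1P[->|vvs].
    rewrite (absvM ua) (absvX ua) (le_lt_trans _ uy) // ler_piMl ?(absv_ge0 ua)
      //.
    by rewrite exprn_ile1 // (absv_ge0 ua).
  have [[va _] _] := vsP' v vvs; have := rP v vvs.
  rewrite (absvM va) (absvX va) mulrDr mulr1; apply: le_lt_trans.
  by rewrite lerDl exprn_ge0 // (absv_ge0 va).
(* now z is large at v0 and at u: divide y by 1 + z ^ (- r), which tends to 1
   at both and to infinity elsewhere *)
pose s := z^-1.
have near0 : \forall r \near \oo, v0 s ^+ r < v0 y - 1.
  apply: expr_near_small; rewrite ?(absv_ge0 v0a) ?subr_gt0 //.
  by rewrite (absvV v0a) invf_lt1 // (lt_trans ltr01).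
have nearu : \forall r \near \oo, u s ^+ r < 1 - u y.
  apply: expr_near_small; rewrite ?(absv_ge0 ua) ?subr_gt0 //.
  by rewrite (absvV ua) invf_lt1 // (lt_trans ltr01).
have [r [[r0 ru] rvs]] := filter_ex (filterI (filterI near0 nearu) small).
have low (v : K -> R) : absolute_value v -> v (1 + s ^+ r) <= 1 + v s ^+ r /\
    1 - v s ^+ r <= v (1 + s ^+ r) /\ v s ^+ r - 1 <= v (1 + s ^+ r).
  move=> va; have := absvD va 1 (s ^+ r);
    have := absvB va (1 + s ^+ r) (s ^+ r).
  have := absvB va (1 + s ^+ r) 1.
  rewrite addrK [1 + _]addrC addrK (absv1 va) (absvX va); lra.
have sr0 : 1 + s ^+ r != 0.
  have [_ [lo _]] := low _ ua; have := absv_ge0 ua y.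
  by move=> y0; apply/eqP => E; move: lo; rewrite E (absv0 ua); lra.
have pos (v : K -> R) : absolute_value v -> 0 < v (1 + s ^+ r).
  by move=> va; rewrite (absv_gt0 va).
exists (y / (1 + s ^+ r)); split.
  rewrite (absvM v0a) (absvV v0a) ltr_pdivlMr ?pos // mul1r.
  by have [lo _] := low _ v0a; lra.
move=> v; rewrite inE => /predU1P[->|vvs].
  rewrite (absvM ua) (absvV ua) ltr_pdivrMr ?pos // mul1r.
  by have [_ [lo _]] := low _ ua; lra.
have [[va _] _] := vsP' v vvs; have [_ [_ lo]] := low _ va.
rewrite (absvM va) (absvV va) ltr_pdivrMr ?pos // mul1r.
apply: lt_le_trans lo; rewrite ltrBrDr /s (absvV va) exprVn.
have z0' : z != 0 by apply: contraTneq z0 => ->;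
  rewrite (absv0 v0a) ltNge ler01.
by rewrite -[X in _ < X]mul1r ltr_pdivlMr ?exprn_gt0 ?(absv_gt0 va) // mulrC
  rvs.
Qed.

(** Choose for each absolute value an element that is large there and small at
    all the others.  High powers of these elements are linearly independent: in
    a relation, the term with the largest coefficient dominates at its own
    absolute value. *)
Lemma extensions_leq_dim (vs : seq (K -> R)) : uniq vs ->
  {in vs, forall v, extends_abs v} -> (size vs <= \dim {:K})%N.
Proof.
move=> vs_uniq vsP; set m := size vs; pose v (i : 'I_m) := nth (fun=> 0) vs i.
have v_in i : v i \in vs by rewrite mem_nth.
have vP i : absolute_value (v i) by case: (vsP _ (v_in i)).
have /choice[z zP] (i : 'I_m) :
    exists z, 1 < v i z /\ forall j, j != i -> v j z < 1.
  have [||z [z1 zs]] := @extension_dominates (v i) [seq u <- vs | u != v i].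
  - exact: vsP.
  - by move=> u; rewrite mem_filter => /andP[? /vsP]; split.
  exists z; split=> // j ji; apply: zs; rewrite mem_filter v_in andbT.
  by rewrite nth_uniq.
have : \forall r \near \oo, {in enum {: 'I_m * 'I_m}, forall ij,
    ij.1 != ij.2 -> v ij.1 (z ij.2) ^+ r < m%:R^-1}.
  apply: near_all_seq => -[i j] _ /=; have [->|ij] := eqVneq i j;
    first by near=> r.
  have m0 : (0 < m)%N by case: i {ij} => i; apply: leq_trans.
  have : \forall r \near \oo, v i (z j) ^+ r < m%:R^-1.
    apply: expr_near_small; rewrite ?(absv_ge0 (vP i)) ?invr_gt0 ?ltr0n //.
    by apply: (zP j).2.
  exact: filterS.
move=> /filter_ex[r rP]; pose X := [tuple z i ^+ r | i < m].
suff : free X.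
  by move/eqP => dX; rewrite -{1}(size_tuple X) -dX; exact/dimvS/subvf.
apply/freeP => k kX i0.
have {}kX : \sum_(j < m) k j *: z j ^+ r = 0.
  rewrite -[RHS]kX; apply: eq_bigr => j _; congr (_ *: _).
  by rewrite -tnth_nth tnth_mktuple.
apply/eqP/negPn/negP => ki0.
have aE (i j : 'I_m) q : v i q%:A = v j q%:A.
  by have [_ ->] := vsP _ (v_in i); have [_ ->] := vsP _ (v_in j).
have [i _ imax] := @arg_maxP _ _ _ i0 xpredT (fun j => v i0 (k j)%:A) isT.
set A := v i0 (k i)%:A in imax.
have A0 : 0 < A.
  rewrite (lt_le_trans _ (imax i0 isT)) // (absv_gt0 (vP i0)).
  by rewrite scaler_eq0 oner_eq0 orbF.
move: kX; rewrite (bigD1 i) //= => /eqP; rewrite addr_eq0 => /eqP kX.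
have := congr1 (v i) kX; rewrite (absvN (vP i)) absvZ // (aE i i0) -/A.
rewrite (absvX (vP i)) => E.
have : A <= v i (\sum_(j < m | j != i) k j *: z j ^+ r).
  by rewrite -E ler_peMr ?(ltW A0) // exprn_ege1 // ltW //; case: (zP i).
apply/negP; rewrite -ltNge (le_lt_trans (absv_sum (vP i) _ _ _)) //.
have m0 : (0 < m)%N by case: (i0) => j; apply: leq_trans.
have AE : A = A / m%:R + \sum_(j < m | j != i) A / m%:R.
  rewrite -(bigD1 i (P := xpredT) (F :=
    fun=> A / m%:R)) //= sumr_const card_ord.
  by rewrite -[RHS]mulr_natr divfK // pnatr_eq0 -lt0n.
rewrite [ltRHS]AE ltr_pwDl ?divr_gt0 ?ltr0n //; apply: ler_sum => j ji.
rewrite absvZ // (aE i i0) (absvX (vP i)).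
apply: ler_pM; rewrite ?(absv_ge0 (vP i0)) ?exprn_ge0 ?(absv_ge0 (vP i)) //.
  exact: imax.
by rewrite ltW // (rP (i, j)) ?mem_enum //= eq_sym.
Unshelve. all: by end_near. Qed.

Lemma finite_extensions : finite_set [set v : K -> R | extends_abs v].
Proof.
apply: contrapT => /(infinite_set_fset (\dim {:K}).+1)[B BP].
apply/negP; rewrite -leqNgt; apply: (extensions_leq_dim (fset_uniq B)) => v vB.
exact: BP.
Qed.

End Extensions.

Section Places.
Variables (R : realType) (K : fieldExtType rat).

Lemma place_absolute_value (v : K -> R) : place v -> absolute_value v.
Proof. by case. Qed.

Lemma padic_abs_int p (n : int) : n != 0 ->
  padic_abs R p n%:~R = (p%:R ^+ logn p `|n|%N)^-1.
Proof.
move=> n0; rewrite /padic_abs intr_eq0 (negPf n0).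
by rewrite denq_int numq_int logn1 expr0 div1r.
Qed.

Lemma padic_abs_nat_le1 p (n : nat) : prime p -> padic_abs R p n%:Q <= 1.
Proof.
move=> p_prime; have [->|n0] := eqVneq n 0%N; first by rewrite /padic_abs eqxx.
rewrite padic_abs_int // invf_le1 ?exprn_gt0 ?ltr0n ?prime_gt0 //.
by rewrite exprn_ege1 // ler1n prime_gt0.
Qed.

Lemma padic_abs_inv p : prime p -> 1 < padic_abs R p (p%:Q^-1).
Proof.
move=> p_prime; have p0 : (p : int) != 0 by rewrite -lt0n prime_gt0.
rewrite /padic_abs invr_eq0 intr_eq0 (negPf p0) denqVz //.
have -> : numq (p%:Q^-1) = 1.
  have -> : p%:Q^-1 = 1%:~R / p%:~R by rewrite mul1r.
  by rewrite coprimeq_num ?coprime1n // mulr1 gtr0_sg // ltz_nat prime_gt0.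
by rewrite logn1 expr0 divr1 !absz_nat logn_prime // eqxx expr1 ltr1n prime_gt1.
Qed.

Lemma standard_abs_gt1 (a : rat -> R) : standard_abs a -> exists q, 1 < a q.
Proof.
case=> [aE|[p p_prime aE]]; last by exists p%:Q^-1; rewrite aE padic_abs_inv.
by exists 2%:R; rewrite aE ratr_nat normr_nat ltr1n.
Qed.

(** In the binomial expansion of the n-th power of a sum, each of the n + 1
    terms is at most the n-th power of the maximum. *)
Lemma absv_ultrametric (F : fieldType) (v : F -> R) : absolute_value v ->
  (forall n : nat, v n%:R <= 1) -> forall x y, v (x + y) <= Num.max (v x) (v y).
Proof.
move=> vP vn x y; set t := Num.max _ _.
have t0 : 0 <= t by rewrite le_max (absv_ge0 vP).
move: (t0); rewrite le_eqVlt => /predU1P[t0'|t_gt0].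
  rewrite -t0' (le_trans (absvD vP _ _)) // t0' /t.
  have : v x <= t /\ v y <= t by rewrite !le_max !lexx orbT.
  by move=> [vx vy]; rewrite (le_trans (lerD vx vy)) // -t0' addr0.
rewrite -[leRHS]mul1r -ler_pdivrMr //; apply: (@le1_linear_growth _ 1) => n.
rewrite mul1r exprMn -(absvX vP) exprVn ler_pdivrMr ?exprn_gt0 // exprDn.
rewrite (le_trans (absv_sum vP _ _ _)) //.
have -> : n.+1%:R * t ^+ n = \sum_(i < n.+1) t ^+ n.
  by rewrite sumr_const card_ord mulr_natl.
apply: ler_sum => i _; rewrite -mulr_natl !(absvM vP) !(absvX vP).
have i_le : (i <= n)%N by rewrite -ltnS.
rewrite -[t ^+ n]mul1r; apply: ler_pM;
  rewrite ?mulr_ge0 ?exprn_ge0 ?(absv_ge0 vP) //.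
have -> : t ^+ n = t ^+ (n - i) * t ^+ i by rewrite -exprD subnK.
apply: ler_pM; rewrite ?exprn_ge0 ?(absv_ge0 vP) // lerXn2r ?nnegrE ?(absv_ge0
  vP) //.
  by rewrite le_max lexx.
by rewrite le_max lexx orbT.
Qed.

Lemma absv_sum_lt (F : fieldType) (v : F -> R) (B : R) (n : nat)
    (G : 'I_n -> F) :
  absolute_value v -> (forall x y, v (x + y) <= Num.max (v x) (v y)) ->
  0 < B -> (forall i, v (G i) < B) -> v (\sum_(i < n) G i) < B.
Proof.
move=> vP vmax B0 GB; elim/big_ind: _ => [|x y vx vy|i _];
  rewrite ?(absv0 vP) //.
by rewrite (le_lt_trans (vmax x y)) // gt_max vx.
Qed.

(** If x were large, the leading term would exceed all the others in the
    equation of x, which an ultrametric absolute value forbids. *)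
Lemma root_absv_le1 (F : fieldType) (v : F -> R) (g : {poly int}) (x : F) :
  absolute_value v -> (forall n : nat, v n%:R <= 1) ->
  v (lead_coef g)%:~R = 1 -> root (map_poly intr g) x -> v x <= 1.
Proof.
move=> vP vn vlead /rootP; rewrite leNgt; apply: contraPN => vx.
have v_int n : v n%:~R <= 1.
  by case: n => n; rewrite ?NegzE ?mulrNz ?(absvN vP); exact: vn.
pose n := (size g).-1; have g0 : g != 0.
  by apply: contra_eqN vlead => /eqP ->;
    rewrite lead_coef0 (absv0 vP) eq_sym oner_eq0.
have sg : size g = n.+1 by rewrite prednK // lt0n size_poly_eq0.
rewrite (@horner_coef_wide _ n.+1) -?sg ?size_poly // sg.
rewrite big_ord_recr /= coef_map /=.
rewrite -[g`_n]/(lead_coef g) addrC => /eqP;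
  rewrite addr_eq0 => /eqP/(congr1 v).
rewrite (absvN vP) (absvM vP) vlead mul1r (absvX vP).
apply/eqP; rewrite gt_eqF //; have x0 := lt_trans ltr01 vx.
apply: absv_sum_lt => //; first exact: absv_ultrametric.
  by rewrite exprn_gt0.
move=> i; rewrite coef_map /= (absvM vP) (absvX vP).
apply: (@le_lt_trans _ _ (v x ^+ i)); last by rewrite ltr_eXn2l ?ltn_ord.
by rewrite ler_piMl ?exprn_ge0 ?(ltW x0).
Qed.

(** A place above p that is large at x forces p to divide the leading
    coefficient of g, and each standard absolute value has finitely many
    extensions. *)
Lemma finite_large_places (g : {poly int}) (x : K) :
  g != 0 -> root (map_poly intr g) x ->
  finite_set [set v : K -> R | place v /\ 1 < v x].
Proof.
move=> g0 gx; pose c := `|lead_coef g|%N.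
have c0 : (0 < c)%N by rewrite absz_gt0 lead_coef_eq0.
have fin a : standard_abs a -> finite_set [set v : K -> R | extends_abs a v].
  by move=> /standard_abs_gt1[q]; apply: finite_extensions.
pose S := [set v : K -> R | extends_abs (fun q => `|ratr q|) v] `|`
  \bigcup_(p in [set` primes c])
    [set v : K -> R | extends_abs (padic_abs R p) v].
apply: (@sub_finite_set _ _ S).
  move=> v [vpl vx]; have vP := place_absolute_value vpl;
    case: vpl => _ _ _ _ [va|[p pp va]].
    by left.
  right; exists p => //=; rewrite mem_primes pp c0 /=;
    apply: contraTT vx => pc; rewrite -leNgt.
  have v_nat (n : nat) : v n%:R = padic_abs R p n%:Q.
    by rewrite -va -[_%:A]/(in_alg K _) -pmulrn rmorph_nat.
  apply: (root_absv_le1 vP _ _ gx) => [n|];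
    first by rewrite v_nat padic_abs_nat_le1.
  have -> : v (lead_coef g)%:~R = v c%:R.
    by rewrite /c; case: (lead_coef g) => m //=;
      rewrite NegzE mulrNz (absvN vP).
  rewrite v_nat padic_abs_int -?lt0n //.
  by rewrite (@logn_coprime p c) ?expr0 ?invr1 ?prime_coprime.
rewrite finite_setU; split; first by apply: fin; left.
apply: bigcup_finite; first exact: finite_seq.
by move=> p /=; rewrite mem_primes => /andP[pp _]; apply: fin; right; exists p.
Qed.

End Places.

(** * Embeddings *)

Lemma exists_rational_minpoly (K : fieldExtType rat) (x : K) :
  exists2 mu : {poly rat}, mu \is monic & map_poly (in_alg K) mu = minPoly 1 x.
Proof.
have [/polyOver1P[mu muE] mon] := (minPolyOver 1 x, monic_minPoly 1 x).
by exists mu; rewrite ?muE // -(map_monic (in_alg K)) -muE.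
Qed.

Section Generator.
Variables (K : fieldExtType rat) (x : K).
Hypothesis x_gen : (<<1; x>> = {:K})%VS.
Variable mu : {poly rat}.
Hypotheses (mu_monic : mu \is monic)
  (muE : map_poly (in_alg K) mu = minPoly 1 x).

Lemma size_minpoly : size mu = (\dim {:K}).+1.
Proof.
rewrite -(size_map_poly (in_alg K)) muE size_minPoly -x_gen.
by rewrite dim_Fadjoin dimv1 muln1.
Qed.

Lemma generator_polynomial y :
  exists q : {poly rat}, (map_poly (in_alg K) q).[x] = y.
Proof.
have : y \in <<1; x>>%VS by rewrite x_gen memvf.
by move/Fadjoin1_polyP => [q ->]; exists q.
Qed.

Lemma minpoly_root (L : numFieldType) (r : L) (q : {poly rat}) :
  root (map_poly ratr mu) r -> (map_poly (in_alg K) q).[x] = 0 ->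
  (map_poly ratr q).[r] = 0.
Proof.
move=> /rootP mur qx; have : mu %| q.
  rewrite -(dvdp_map (in_alg K)) muE; apply: minPoly_dvdp; last exact/rootP.
  by apply/polyOver1P; exists q.
by move/dvdpP => [h ->]; rewrite rmorphM hornerM mur mulr0.
Qed.

(** Write y as a polynomial in x and evaluate it at r; the result depends on y
    only, because the minimal polynomial vanishes at r. *)
Lemma exists_embedding (L : numFieldType) (r : L) : root (map_poly ratr mu) r ->
  exists f : {rmorphism K -> L}, f x = r.
Proof.
move=> mur; have /choice[Q QP] := generator_polynomial.
have fE q y : (map_poly (in_alg K) q).[x] = y ->
    (map_poly ratr (Q y)).[r] = (map_poly ratr q).[r].
  move=> qy; apply/eqP; rewrite -subr_eq0 -hornerN -hornerD -rmorphB; apply/eqP.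
  by apply: minpoly_root => //; rewrite rmorphB hornerD hornerN QP qy subrr.
pose f y := (map_poly ratr (Q y)).[r].
have fB : {morph f : y z / y - z}.
  move=> y z; rewrite /f (fE (Q y - Q z)) ?rmorphB ?hornerD ?hornerN //.
  by rewrite !QP.
have fM : monoid_morphism f.
  split; first by rewrite /f (fE 1) ?rmorph1 ?hornerC.
  move=> y z; rewrite /f (fE (Q y * Q z)) ?rmorphM ?hornerM //.
  by rewrite !QP.
pose fA := GRing.isZmodMorphism.Build K L f fB.
pose fM' := GRing.isMonoidMorphism.Build K L f fM.
pose F : {rmorphism K -> L} := HB.pack f fA fM'.
exists F; rewrite -[LHS]/(f x) /f (fE 'X) ?map_polyX ?hornerX //.
Qed.

Lemma minpoly_splits (L : numClosedFieldType) : exists rs : seq L,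
  [/\ uniq rs, size rs = \dim {:K} &
      map_poly ratr mu = \prod_(r <- rs) ('X - r%:P)].
Proof.
have [rs rsE] := closed_field_poly_normal (map_poly ratr mu : {poly L}).
rewrite lead_coef_map (eqP mu_monic) rmorph1 scale1r in rsE.
exists rs; split=> //.
  rewrite -separable_prod_XsubC -rsE separable_map.
  rewrite -(separable_map (in_alg K)) muE.
  by apply: pcharf0_separable => p; rewrite pchar_lalg pchar_num.
apply: succn_inj; rewrite -size_minpoly -(size_map_poly (ratr : rat -> L)) rsE.
by rewrite size_prod_XsubC.
Qed.

End Generator.

Lemma rmorph_alg_ratr (K : fieldExtType rat) (L : numFieldType)
    (f : {rmorphism K -> L}) q :
  f q%:A = ratr q.
Proof. by rewrite alg_num_field fmorph_rat. Qed.

Section Fibre.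
Variables (R : realType) (K : fieldExtType rat) (L : numFieldType) (w : L -> R).
Hypothesis wP : absolute_value w.

(** Dedekind's independence of characters, made effective.  With more embeddings
    than basis elements, some nontrivial combination of them kills the basis of
    K_v at a given stage k, hence is small at all elements of K that are well
    approximated there; at the first powers of x this contradicts the
    invertibility of a Vandermonde matrix. *)
Lemma embeddings_leq_local_degree (v : K -> R) (x : K) (m n : nat)
    (b : 'I_n -> nat -> K) (f : 'I_m -> {rmorphism K -> L}) :
  completion_basis v b -> (forall j y, w (f j y) = v y) ->
  injective (fun j => f j x) -> (m <= n)%N.
Proof.
move=> [_ b_span _] fv f_inj; rewrite leqNgt; apply/negP => lt_nm.
have vP : absolute_value v.
  have j0 : 'I_m by exists n.
  by rewrite -(funext (fv j0)); exact: absolute_value_comp.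
pose a : 'rV[L]_m := \row_j f j x; pose U := (Vandermonde m a)^T.
have U_unit : U \in unitmx.
  rewrite unitmx_tr unitmxE det_Vandermonde unitfE.
  apply/prodf_neq0 => i _; apply/prodf_neq0 => j ij.
  rewrite !mxE subr_eq0; apply: contraTneq ij => /f_inj ->.
  by rewrite ltnn.
pose C := \sum_(l < m) \sum_(j < m) w (invmx U l j) + 1.
have C0 : 0 < C.
  rewrite ltr_wpDl // sumr_ge0 // => l _; rewrite sumr_ge0 // => j _.
  exact: absv_ge0.
have /choice[q qP] (l : 'I_m) : exists q : 'I_n -> nat -> rat,
    null_seq v (fun k => x ^+ l - \sum_(i < n) q i k *: b i k).
  by have [q _ qP] := b_span _ (cauchy_seq_cst vP (x ^+ l)); exists q.
have [k kP] : exists k, forall l : 'I_m,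
    v (x ^+ l - \sum_(i < n) q l i k *: b i k) < C^-1.
  have near_l : \forall k \near \oo, {in enum 'I_m, forall l : 'I_m,
      v (x ^+ l - \sum_(i < n) q l i k *: b i k) < C^-1}.
    apply: near_all_seq => l _.
    have [|N NP] := (null_seqP vP _).1 (qP l) C^-1; first by rewrite invr_gt0.
    by exists N.
  have [k kP] := filter_ex near_l; exists k => l; apply: kP;
    rewrite mem_enum //.
pose A : 'M[L]_(m, n) := \matrix_(j, i) f j (b i k).
have /rowV0Pn[la /sub_kermxP laA la0] : kermx A != 0.
  rewrite -mxrank_eq0 mxrank_ker -lt0n subn_gt0.
  exact: leq_ltn_trans (rank_leq_col A) lt_nm.
pose S := \sum_(j < m) w (la 0 j).
have S0 : 0 < S.
  have [j laj] : exists j, la 0 j != 0.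
    apply: contrapT => /forallNP la_eq0; case/eqP: la0; apply/rowP => j.
    by rewrite mxE; apply/eqP/negPn/negP.
  rewrite /S (bigD1 j) //= ltr_pwDl ?(absv_gt0 wP) //.
  by rewrite sumr_ge0 // => i _; exact: absv_ge0.
have laU l : w ((la *m U) 0 l) <= S * C^-1.
  have -> : (la *m U) 0 l =
      \sum_j la 0 j * f j (x ^+ l - \sum_(i < n) q l i k *: b i k).
    rewrite mxE; under [RHS]eq_bigr do rewrite rmorphB mulrBr.
    rewrite sumrB [X in _ - X](_ : _ = 0) ?subr0.
      by apply: eq_bigr => j _; rewrite !mxE rmorphXn.
    under eq_bigr do rewrite rmorph_sum mulr_sumr.
    rewrite exchange_big big1 //= => i _.
    have /rowP/(_ i) := laA; rewrite !mxE => laA_i.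
    transitivity (ratr (q l i k) * \sum_j la 0 j * A j i);
      last by rewrite laA_i mulr0.
    rewrite mulr_sumr; apply: eq_bigr => j _.
    by rewrite mxE -mulr_algl rmorphM rmorph_alg_ratr mulrCA.
  rewrite (le_trans (absv_sum wP _ _ _)) // mulr_suml; apply: ler_sum => j _.
  by rewrite (absvM wP) fv ler_wpM2l ?(absv_ge0 wP) // ltW.
have : S < S.
  have laE j : la 0 j = \sum_l (la *m U) 0 l * invmx U l j.
    by rewrite -[in LHS](mulmxK U_unit la) mxE.
  rewrite {1}/S; apply: (@le_lt_trans _ _
    (\sum_(j < m) \sum_(l < m) S * C^-1 * w (invmx U l j))).
    apply: ler_sum => j _; rewrite laE (le_trans (absv_sum wP _ _ _)) //.
    by apply: ler_sum => l _; rewrite (absvM wP) ler_wpM2r ?(absv_ge0 wP).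
  rewrite exchange_big /=; under eq_bigr do rewrite -mulr_sumr;
    rewrite -mulr_sumr.
  rewrite -mulrA gtr_pMr // ltr_pdivrMl // mulr1.
  by rewrite /C ltrDl.
by rewrite ltxx.
Qed.

End Fibre.

(** The coefficients are signed sums of products of roots; for an ultrametric
    absolute value (kappa = 1) no constant is lost. *)
Lemma coef_prod_XsubC_le (R : realType) (L : fieldType) (w : L -> R) (kappa : R)
    (rs : seq L) i : absolute_value w -> 1 <= kappa ->
  (forall y z, w (y - z) <= kappa * Num.max (w y) (w z)) ->
  w (\prod_(r <- rs) ('X - r%:P))`_i <=
    kappa ^+ size rs * \prod_(r <- rs) Num.max 1 (w r).
Proof.
move=> wP k1 wk; have k0 := lt_le_trans ltr01 k1.
have max1 r : 1 <= Num.max 1 (w r) by rewrite le_max lexx.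
elim: rs i => [|r rs IHrs] i.
  rewrite !big_nil expr0 mul1r coef1; case: eqP => _; rewrite ?(absv1 wP) //.
  by rewrite (absv0 wP).
set B := kappa ^+ size rs * \prod_(r <- rs) Num.max 1 (w r) in IHrs.
have B0 : 0 <= B by rewrite (le_trans (absv_ge0 wP _) (IHrs 0%N)).
rewrite !big_cons /= exprS mulrACA -/B mulrBl coefB coefXM coefCM.
rewrite (le_trans (wk _ _)) // -mulrA ler_wpM2l ?(ltW k0) //.
rewrite ge_max; apply/andP; split.
  case: eqP => _; first by rewrite (absv0 wP) mulr_ge0 // (le_trans ler01).
  by rewrite (le_trans (IHrs _)) // ler_peMl.
rewrite (absvM wP); apply: ler_pM; rewrite ?(absv_ge0 wP) //.
by rewrite le_max lexx orbT.
Qed.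

Lemma fieldExt_dim_gt0 (K : fieldExtType rat) : (0 < \dim {:K})%N.
Proof. exact: adim_gt0. Qed.

(** * The height bounds the minimal polynomial *)

Section HeightLowerBound.
Variables (R : realType) (K : fieldExtType rat) (x : K).
Hypothesis x_gen : (<<1; x>> = {:K})%VS.

(** The index [None] stands for the archimedean absolute value. *)
Definition standard_abs_at (s : option nat) (q : rat) : R :=
  if s is Some p then padic_abs R p q else `|ratr q|.

Definition standard_place (s : option nat) : bool :=
  if s is Some p then prime p else true.

(** The constant kappa of [coef_prod_XsubC_le]: it must be 1 at the primes, so
    that the loss in the product over all s stays bounded. *)
Definition ultrametric_constant (s : option nat) : R :=
  if s is Some _ then 1 else 2%:R.

Lemma standard_abs_atP s : standard_place s -> standard_abs (standard_abs_at s).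
Proof. by case: s => [p|] /= ps; [right; exists p | left]. Qed.

Lemma padic_abs_prime p q : prime p -> prime q ->
  padic_abs R q p%:Q = if q == p then p%:R^-1 else 1.
Proof.
move=> pp pq; rewrite padic_abs_int -?lt0n ?prime_gt0 // logn_prime //.
by case: eqP => [->|]; rewrite ?expr1 ?expr0 ?invr1.
Qed.

(** A prime p has size less than 1 at p, size 1 at the other primes, and size p
    at infinity. *)
Lemma standard_abs_at_inj s t : standard_place s -> standard_place t ->
  standard_abs_at s =1 standard_abs_at t -> s = t.
Proof.
wlog [p ->] : s t / exists p, s = Some p.
  move=> W; case: s t => [p|] [q|] // ps pt E.
  - by apply: W => //; exists p.
  - by apply: W => //; exists p.
  - by apply/esym; apply: W => //; exists q.
move=> /= pp pt /(_ p%:Q) /=; rewrite padic_abs_prime // eqxx.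
have p1 : p%:R^-1 < 1 :> R.
  by rewrite invf_lt1 ?ltr1n ?ltr0n ?prime_gt1 ?prime_gt0.
case: t pt => [q pq|_] /= E; last first.
  by move: p1; rewrite E ratr_int normr_nat ltNge ler1n prime_gt0.
by move: p1; rewrite E padic_abs_prime //; case: eqP => [->//|_]; rewrite ltxx.
Qed.

(** The complex numbers at infinity, the algebraic numbers at a prime. *)
Lemma exists_closed_extension s : standard_place s ->
  exists (L : numClosedFieldType) (w : L -> R),
    [/\ absolute_value w, forall q, w (ratr q) = standard_abs_at s q &
        forall y z, w (y - z) <= ultrametric_constant s * Num.max (w y) (w z)].
Proof.
case: s => [p|] /= ps.
  have [w [wP wmax wq]] := exists_padic_absolute_value R ps.
  exists algC, w; split=> // y z; rewrite mul1r.
  by rewrite (le_trans (wmax _ _)) // (absvN wP).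
exists (complex R), (@Normc.normc R).
have wP : absolute_value (@Normc.normc R).
  split.
  - by case=> a b; exact: sqrtr_ge0.
  - by move=> y; split=> [/Normc.eq0_normc|->]; rewrite ?Normc.normc0.
  - exact: Normc.normcM.
  - exact: le_normcD.
split=> // [q|y z].
  rewrite -(fmorph_rat (real_complex R)) /= expr0n /= addr0 sqrtr_sqr //.
rewrite (le_trans (absvB wP _ _)) // -[2%:R]/(1 + 1) mulrDl mul1r.
by rewrite lerD // le_max lexx ?orbT.
Qed.

Variable mu : {poly rat}.
Hypotheses (mu_monic : mu \is monic)
  (muE : map_poly (in_alg K) mu = minPoly 1 x).

(** E lists the absolute values induced by the embeddings that send x to each
    of its conjugates, so the product over E is that of the max(1, |r|) over the
    conjugates r. *)
Lemma exists_embedding_places s : standard_place s ->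
  exists E : seq (K -> R),
    [/\ {in E, forall v, extends_abs (standard_abs_at s) v},
        forall v, (count_mem v E <= local_degree v)%N &
        forall i, standard_abs_at s mu`_i <=
          ultrametric_constant s ^+ (\dim {:K}) *
          \prod_(v <- E) Num.max 1 (v x)].
Proof.
move=> ps; have [L [w [wP wq wk]]] := exists_closed_extension ps.
have [rs [rs_uniq rs_size rsE]] := minpoly_splits x_gen mu_monic muE L.
have [f0 _] : exists f : {rmorphism K -> L}, f x = head 0 rs.
  apply: (exists_embedding x_gen muE); rewrite rsE root_prod_XsubC.
  have := fieldExt_dim_gt0 K; rewrite -rs_size.
  by case: (rs) => // r rs' _; rewrite mem_head.
have /choice[f fP] (r : L) : exists f : {rmorphism K -> L}, r \in rs -> f x = r.
  have [r_rs|] := boolP (r \in rs); last by exists f0.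
  have [|f fx] := exists_embedding x_gen muE (r := r); last by exists f.
  by rewrite rsE root_prod_XsubC.
have ext r : extends_abs (standard_abs_at s) (fun y => w (f r y)).
  split=> [|q]; first exact: absolute_value_comp.
  by rewrite rmorph_alg_ratr wq.
exists [seq (fun y => w (f r y)) | r <- rs]; split.
- by move=> _ /mapP[r _ ->]; exact: ext.
- move=> v; rewrite count_map; set P := preim _ _.
  rewrite -size_filter; set rv := [seq r <- rs | P r].
  have rvP (j : 'I_(size rv)) : P (nth 0 rv j) && (nth 0 rv j \in rs).
    by rewrite -mem_filter mem_nth.
  have [->//|rv0] := posnP (size rv).
  have vP : absolute_value v.
    have /andP[/eqP <- _] := rvP (Ordinal rv0).
    by case: (ext (nth 0 rv 0)).
  have [b bP] := local_degreeP vP.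
  apply: (@embeddings_leq_local_degree _ _ _ _ wP v x _ _ b
    (fun j => f (nth 0 rv j))) => //.
    by move=> j y; have /andP[/eqP <-] := rvP j.
  move=> i j /=; have /andP[_ irs] := rvP i; have /andP[_ jrs] := rvP j.
  rewrite !fP // => /eqP; rewrite nth_uniq ?filter_uniq // => /eqP E.
  exact: val_inj.
- move=> i; rewrite -wq -coef_map rsE -rs_size.
  rewrite big_map (eq_big_seq (fun r => Num.max 1 (w r))) => [|r r_rs];
    last by rewrite fP.
  by apply: coef_prod_XsubC_le => //; case: (s) => //=; rewrite ler1n.
Qed.

(** The other factors of the height are at least 1, and all but finitely many
    of them are equal to 1. *)
Lemma prod_places_le_height (vs : seq (K -> R)) (g : {poly int}) :
  g != 0 -> root (map_poly intr g) x -> uniq vs -> {in vs, forall v, place v} ->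
  \prod_(v <- vs) Num.max 1 (v x) ^+ local_degree v <=
  height R x ^+ (\dim {:K}).
Proof.
move=> g0 gx vs_uniq vs_place; set D := \dim {:K}.
have D0 : (0 < D)%N by exact: fieldExt_dim_gt0.
pose F (v : K -> R) := Num.max 1 (v x) `^ ((local_degree v)%:R / D%:R).
have max1 (v : K -> R) : 1 <= Num.max 1 (v x) by rewrite le_max lexx.
have F1 v : 1 <= F v.
  by rewrite -(powRr0 (Num.max 1 (v x))) ?ler_powR // divr_ge0.
have FD v : F v ^+ D = Num.max 1 (v x) ^+ local_degree v.
  rewrite -powR_mulrn ?powR_ge0 // -powRrM divfK ?pnatr_eq0 -?lt0n //.
  by rewrite powR_mulrn // (le_trans ler01).
have /finite_fsetP[S SE] := finite_large_places R g0 gx.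
pose r := undup (finmap.enum_fset S ++ vs).
have rP v : v \in r -> place v.
  rewrite mem_undup mem_cat => /orP[vS|/vs_place//].
  have : [set` S] v by [].
  by rewrite -SE => -[].
have -> : height R x = \prod_(v <- r) F v.
  rewrite /height (@fsbigE _ _ _ _ _ r) ?undup_uniq //.
    rewrite [LHS]big_seq_cond [RHS]big_seq; apply: eq_bigl => v.
    by case: (boolP (v \in r)) => //= /rP vpl; rewrite mem_set.
  move=> v vpl vr; have : v x <= 1.
    rewrite leNgt; apply/negP => vx; move: vr;
      rewrite mem_undup mem_cat negb_or => /andP[/negP + _]; apply.
    by have : [set` S] v by rewrite -SE.
  by move=> vx; rewrite max_l // powR1.
rewrite -prodrXl; under [leRHS]eq_bigr do rewrite FD.
rewrite [leRHS](bigID (mem vs)) /= -[leLHS]mulr1; apply: ler_pM => //.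
- by rewrite prodr_ge0 // => v _; rewrite exprn_ge0 // (le_trans ler01).
- rewrite -[X in _ <= X]big_filter (perm_big [seq v <- r | v \in vs]) //.
  apply: uniq_perm; rewrite ?filter_uniq ?undup_uniq // => v.
  by rewrite mem_filter mem_undup mem_cat andb_orr andbb orb_idl // => /andP[].
- by elim/big_ind: _ => // [y z y1 z1|v _];
  [rewrite mulr_ege1 | rewrite exprn_ege1].
Qed.

End HeightLowerBound.

Lemma count_flatten_disjoint (I T : eqType) (ss : seq I) (E : I -> seq T)
    (N : T -> nat) :
  uniq ss -> {in ss &, forall s t v, v \in E s -> v \in E t -> s = t} ->
  {in ss, forall s v, (count_mem v (E s) <= N v)%N} ->
  forall v, (count_mem v (flatten [seq E s | s <- ss]) <= N v)%N.
Proof.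
elim: ss => //= s ss IHss /andP[s_ss ss_uniq] disj EN v; rewrite count_cat.
have [vs|/count_memPn ->] := boolP (v \in E s); last first.
  apply: IHss => // [t u tss uss|t tss].
    by apply: disj; rewrite inE ?tss ?uss orbT.
  by apply: EN; rewrite inE tss orbT.
rewrite (_ : count_mem v (flatten _) = 0%N) ?addn0.
  by apply: EN; rewrite mem_head.
apply/count_memPn/flatten_mapP => -[t tss vt]; case/negP: s_ss.
by rewrite (disj s t _ _ v vs vt) ?mem_head // inE tss orbT.
Qed.

Lemma padic_absM (R : realType) p : prime p ->
  forall q r, padic_abs R p (q * r) = padic_abs R p q * padic_abs R p r.
Proof.
move=> pp q r; have [w [wP _ wq]] := exists_padic_absolute_value R pp.
by rewrite -!wq rmorphM (absvM wP).
Qed.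

Lemma exists_primitive_multiple (mu : {poly rat}) : mu \is monic ->
  exists f : {poly int},
    [/\ f != 0, map_poly intr f = (lead_coef f)%:~R *: mu &
        forall p, prime p -> exists i, ~~ (p %| `|(f`_i)%R|)%N].
Proof.
move=> mu_monic; have [q [a a0 muE]] := rat_poly_scale mu.
have q0 : q != 0.
  by apply: contraTneq mu_monic => q0;
    rewrite muE q0 rmorph0 scaler0 monicE lead_coef0 eq_sym oner_eq0.
pose f := zprimitive q; have f0 : f != 0 by rewrite zprimitive_eq0.
pose b : rat := (zcontents q)%:~R / a%:~R.
have muE' : mu = b *: map_poly intr f.
  by rewrite muE {1}[q]zpolyEprim map_polyZ scalerA mulrC.
have bl : b * (lead_coef f)%:~R = 1.
  have := monicP mu_monic; rewrite muE' lead_coefZ lead_coef_map_inj //;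
    exact: intr_inj.
exists f; split=> //; first by rewrite muE' scalerA mulrC bl scale1r.
move=> p pp; apply: contrapT => /forallNP all_p.
have : (p %| zcontents f)%Z.
  rewrite dvdz_contents; apply/polyOverP => i; rewrite dvdzE /=.
  by apply/negPn/negP => /all_p.
rewrite zcontents_primitive q0 dvdzE /= dvdn1 => /eqP p1.
by move: pp; rewrite p1.
Qed.

(** Multiply the bounds of [exists_embedding_places] at infinity and at the
    primes dividing the leading coefficient c.  At such a prime p some
    coefficient of the primitive polynomial f is a unit, so its quotient by c,
    a coefficient of the monic polynomial, has p-adic size the p-part of c.
    The product of the p-parts is c, which turns the archimedean bound for the
    monic polynomial into one for f. *)
Lemma coef_minpoly_le_height (R : realType) (K : fieldExtType rat) (x : K) :
  (<<1; x>> = {:K})%VS ->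
  exists f : {poly int},
    [/\ size f = (\dim {:K}).+1, root (map_poly intr f) x &
        forall i, `|f`_i|%:~R <=
          2%:R ^+ (\dim {:K}) * height R x ^+ (\dim {:K})].
Proof.
move=> x_gen; set D := \dim {:K}.
have [mu mu_monic muE] := exists_rational_minpoly x.
have [f [f0 fE f_prim]] := exists_primitive_multiple mu_monic.
have intrK : intr =1 (in_alg K) \o intr :> (int -> K).
  by move=> n; rewrite /= -[RHS]/(in_alg K n%:~R) rmorph_int.
have l0 : (lead_coef f)%:~R != 0 :> rat by rewrite intr_eq0 lead_coef_eq0.
have fx : root (map_poly intr f) x.
  rewrite (eq_map_poly intrK) map_poly_comp fE map_polyZ muE.
  rewrite rootZ ?root_minPoly //.
  by rewrite fmorph_eq0.
exists f; split=> // [|i].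
  rewrite -(size_minpoly x_gen muE) -(size_scale mu l0) -fE.
  by rewrite size_map_inj_poly //; exact: intr_inj.
have mu_i j : mu`_j = (f`_j)%:~R / (lead_coef f)%:~R.
  have := congr1 (fun g : {poly rat} => g`_j) fE;
    rewrite coef_map coefZ /= => ->.
  by rewrite mulrAC divff // mul1r.
pose c := `|lead_coef f|%N;
  have c0 : (0 < c)%N by rewrite absz_gt0 lead_coef_eq0.
have /choice[E EP] s : exists E : seq (K -> R), standard_place s ->
    [/\ {in E, forall v, extends_abs (standard_abs_at R s) v},
        forall v, (count_mem v E <= local_degree v)%N &
        forall i, standard_abs_at R s mu`_i <=
          ultrametric_constant R s ^+ D * \prod_(v <- E) Num.max 1 (v x)].
  have [ps|] := boolP (standard_place s); last by exists [::].
  by have [E] := exists_embedding_places R x_gen mu_monic muE ps; exists E.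
pose ss := None :: [seq Some p | p <- primes c].
have ssP : {in ss, forall s, standard_place s}.
  move=> s; rewrite inE => /predU1P[->//|/mapP[p + ->]].
  by rewrite mem_primes => /andP[].
pose L := flatten [seq E s | s <- ss].
have L_count v : (count_mem v L <= local_degree v)%N.
  apply: count_flatten_disjoint => [|s t sss tss u us ut|s sss].
  - rewrite /= map_inj_uniq ?primes_uniq ?andbT; last by move=> ? ? [].
    by apply/mapP => -[].
  - apply: (standard_abs_at_inj (R := R) (ssP s sss) (ssP t tss)) => q.
    have [Es _ _] := EP s (ssP s sss); have [Et _ _] := EP t (ssP t tss).
    by have [_ <-] := Es u us; have [_ <-] := Et u ut.
  - by have [] := EP s (ssP s sss).
have L_place : {in undup L, forall v, place v}.
  move=> v; rewrite mem_undup => /flatten_mapP[s sss vs].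
  have [/(_ v vs)[[v0 vv0 vM vD] va] _ _] := EP s (ssP s sss).
  by split=> //; rewrite (funext va); exact/standard_abs_atP/ssP.
have L_le : \prod_(v <- L) Num.max 1 (v x) <= height R x ^+ D.
  apply: le_trans (prod_places_le_height f0 fx (undup_uniq L) L_place).
  rewrite -(big_undup_iterop_count _ _ xpredT); apply: ler_prod => v _.
  have max1 : 1 <= Num.max 1 (v x) by rewrite le_max lexx.
  by rewrite -[iterop _ _ _ _]/(_ ^+ _) exprn_ge0 ?(le_trans ler01) //=
    ler_weXn2l.
apply: (@le_trans _ _ (2%:R ^+ D * \prod_(v <- L) Num.max 1 (v x))); last first.
  by rewrite ler_wpM2l // exprn_ge0.
rewrite /L big_flatten big_map big_cons /= mulrA.
have -> : `|f`_i|%:~R = `|ratr mu`_i| * c%:R :> R.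
  have -> : c%:R = `|(lead_coef f)%:~R| :> R by rewrite /c natr_absz intr_norm.
  rewrite mu_i fmorph_div /= !ratr_int normrM normfV divfK ?intr_norm //.
  by rewrite normr_eq0 intr_eq0 lead_coef_eq0.
apply: ler_pM => //; first by have [_ _ /(_ i)] := EP None isT.
have -> : c%:R = \prod_(p <- primes c) p%:R ^+ logn p c :> R.
  rewrite {1}(prod_prime_decomp c0) prime_decompE big_map natr_prod.
  by apply: eq_bigr => p _; rewrite natrX.
rewrite big_map big_seq [leRHS]big_seq; apply: ler_prod => p p_c.
have pp : prime p by move: p_c; rewrite mem_primes => /andP[].
rewrite exprn_ge0 //=; have [j pj] := f_prim p pp.
have [_ _ /(_ j)] := EP (Some p) pp; rewrite /= expr1n mul1r; apply: le_trans.
have fj0 : f`_j != 0 by apply: contraNneq pj => ->; rewrite dvdn0.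
have lead0 : lead_coef f != 0 by rewrite lead_coef_eq0.
have : padic_abs R p mu`_j * padic_abs R p (lead_coef f)%:~R = 1.
  rewrite -padic_absM // mu_i divfK // padic_abs_int //.
  by rewrite logn_coprime ?prime_coprime // expr0 invr1.
by rewrite padic_abs_int // => /divr1_eq ->.
Qed.

(** * Counting fields *)

Lemma exists_generator (K : fieldExtType rat) :
  exists x : K, (<<1; x>> = {:K})%VS.
Proof.
exists (separable_generator 1 {:K}%AS).
rewrite -eq_adjoin_separable_generator ?sub1v //.
by apply/separableP => y _; apply: pcharf0_separable => p;
  rewrite pchar_lalg pchar_num.
Qed.

Lemma height_ge0 (R : realType) (K : fieldExtType rat) (x : K) :
  0 <= height R x.
Proof. by rewrite /height; apply: prodr_ge0 => v _; exact: powR_ge0. Qed.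

Definition rational_span (r : algC) : set algC :=
  range (fun q : {poly rat} => (map_poly ratr q).[r]).

Lemma range_embedding (K : fieldExtType rat) (x : K)
    (iota : {rmorphism K -> algC}) :
  (<<1; x>> = {:K})%VS -> range iota = rational_span (iota x).
Proof.
move=> x_gen; have iotaE q :
    iota (map_poly (in_alg K) q).[x] = (map_poly ratr q).[iota x].
  rewrite -horner_map -map_poly_comp; congr (_.[_]); apply: eq_map_poly => a.
  exact: rmorph_alg_ratr.
apply/seteqP; split=> [_ [y _ <-]|_ [q _ <-]].
  by have [q <-] := generator_polynomial x_gen y; exists q.
by exists (map_poly (in_alg K) q).[x].
Qed.

Lemma card_le_size (T : eqType) (A : set T) (s : seq T) n :
  `I_n #<= A -> A `<=` [set` s] -> (n <= size s)%N.
Proof.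
case: s => [|x0 s] nA As.
  have A0 : A = set0 by apply/seteqP; split=> // x /As.
  move: nA; rewrite A0 card_le0 => /eqP n0; rewrite leqNgt; apply/negP => n_gt0.
  by have : `I_n 0%N by []; rewrite n0.
rewrite -card_le_II; apply: card_le_trans nA _.
apply: card_le_trans (card_image_le (nth x0 (x0 :: s)) _).
apply: subset_card_le => x Ax; have xs : x \in x0 :: s by exact: As.
exists (index x (x0 :: s)); last exact: nth_index.
by rewrite -index_mem in xs.
Qed.

(** The field is Q(r) for a root r of f in the algebraic numbers, hence is
    determined by the D + 1 coefficients of f, each with at most 2 B + 1
    possible values, and by the position of r among the D roots. *)
Lemma bounded_fields_enum (D B : nat) : exists2 s : seq (set algC),
  size s = (D * (2 * B).+1 ^ D.+1)%N &
  forall (K : fieldExtType rat) (iota : {rmorphism K -> algC}) (x : K)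
      (f : {poly int}),
    (<<1; x>> = {:K})%VS -> size f = D.+1 -> root (map_poly intr f) x ->
    (forall i, `|(f`_i)%R| <= B)%N -> range iota \in s.
Proof.
pose P (g : {ffun 'I_D.+1 -> 'I_(2 * B).+1}) : {poly algC} :=
  \poly_(i < D.+1) ((g (inord i))%:Z - B%:Z)%:~R.
pose rs g := sval (closed_field_poly_normal (P g)).
exists [seq rational_span (nth 0 (rs t.2) (t.1 : 'I_D)) |
         t <- enum {: 'I_D * {ffun 'I_D.+1 -> 'I_(2 * B).+1}}].
  by rewrite size_map -cardE card_prod card_ffun !card_ord.
move=> K iota x f x_gen size_f fx f_le.
pose g : {ffun 'I_D.+1 -> 'I_(2 * B).+1} :=
  [ffun i : 'I_D.+1 => inord (absz (f`_i + B%:Z))].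
have PE : P g = map_poly intr f.
  apply/polyP => i; rewrite coef_poly coef_map /=; case: ltnP => [iD|Di];
    last first.
    by rewrite nth_default ?size_f // mulr0z.
  have f_lt : (absz (f`_i + B%:Z)%R < (2 * B).+1)%N by have := f_le i; lia.
  rewrite ffunE (inordK iD) (inordK f_lt); congr (_%:~R).
  have fB0 : 0 <= f`_i + B%:Z by have := f_le i; lia.
  by rewrite gez0_abs // addrK.
have rsE : P g = lead_coef (P g) *: \prod_(r <- rs g) ('X - r%:P).
  by rewrite /rs; case: closed_field_poly_normal.
have size_P : size (P g) = D.+1.
  by rewrite PE size_map_inj_poly //; exact: intr_inj.
have lead0 : lead_coef (P g) != 0.
  by rewrite lead_coef_eq0 -size_poly_eq0 size_P.
have size_rs : size (rs g) = D.
  by apply: succn_inj; rewrite -size_P rsE size_scale // size_prod_XsubC.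
have iota_rs : iota x \in rs g.
  rewrite -root_prod_XsubC -(rootZ _ _ lead0) -rsE PE.
  have -> : map_poly intr f = map_poly iota (map_poly intr f) :> {poly algC}.
    by rewrite -map_poly_comp; apply: eq_map_poly => n; rewrite /= rmorph_int.
  by rewrite fmorph_root.
rewrite (range_embedding iota x_gen).
have iD : (index (iota x) (rs g) < D)%N.
  by rewrite -[X in (_ < X)%N]size_rs index_mem.
by apply/mapP; exists (Ordinal iD, g); rewrite ?mem_enum //= nth_index.
Qed.

Theorem theorem1p3 (R : realType) (D : nat) (hD : (3 < D)%N)
  (hcount : exists c nu : R,
    [/\ 0 < c,
        1 / 2 + 1 / (D%:R - 1) < nu &
        \forall T \near +oo%R,
          exists2 n : nat, c * T `^ nu <= n%:R &
            `I_n #<= subfields_algC D (fun K => abs_discriminant R K <= T)]) :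
  exists2 gamma : R, 1 / (2 * D%:R * (D%:R - 1)) < gamma &
    infinite_set (subfields_algC D (fun K =>
      min_generator_height R K > abs_discriminant R K `^ gamma)).
Proof.
have [c [nu [c0 nu_gt [T0 [_ T0P]]]]] := hcount.
have D4 : 4 <= D%:R :> R by rewrite ler_nat.
pose g0 : R := 1 / (2 * D%:R * (D%:R - 1)).
pose g1 : R := nu / (D%:R * (D%:R + 1)).
have g0_gt0 : 0 < g0 by rewrite /g0 divr_gt0 // mulr_gt0 //; lra.
have g01 : g0 < g1.
  rewrite /g1 ltr_pdivlMr; last by rewrite mulr_gt0; lra.
  rewrite (le_lt_trans _ nu_gt) // /g0 le_eqVlt; apply/orP; left; apply/eqP.
  by field; lra.
pose gamma := (g0 + g1) / 2.
exists gamma; first by rewrite -/g0 /gamma; lra.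
have gamma0 : 0 < gamma by rewrite /gamma; lra.
pose e := gamma * D%:R * (D%:R + 1).
have e_nu : e < nu.
  have : gamma < g1 by rewrite /gamma; lra.
  by rewrite /g1 ltr_pdivlMr ?mulrA //; rewrite mulr_gt0; lra.
set Exc := subfields_algC D _ => /finite_seqP[s ExcE].
pose C : R := (size s)%:R + D%:R * (3 * 4 ^+ D) ^+ D.+1.
have C0 : 0 <= C by rewrite addr_ge0 // mulr_ge0 // exprn_ge0 // mulr_ge0 //
  exprn_ge0.
(* (3 * 4 ^ D) ^ (D + 1) T ^ e bounds (2 B + 1) ^ (D + 1), as B <= r and
   1 <= r *)
have bound T : 1 <= T -> T0 < T -> c * T `^ nu <= C * T `^ e.
  move=> T1 T0T; have [n cn /card_le_size n_le] := T0P T T0T.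
  have Tgt0 : 0 < T by lra.
  have Te x : 0 <= x -> 1 <= T `^ x by move=> x0; rewrite -(powRr0 T) ler_powR.
  (* a height below 2 T ^ gamma bounds the coefficients by
     2 ^ D (2 T ^ gamma) ^ D = r *)
  pose r := (4 * T `^ gamma) ^+ D; pose B := Num.truncn r.
  have r1 : 1 <= r.
    by rewrite exprn_ege1 //; have := Te _ (ltW gamma0); lra.
  have [s' size_s' s'P] := bounded_fields_enum D B.
  rewrite (le_trans cn) //; have /(n_le (s ++ s')) :
      subfields_algC D (fun K => abs_discriminant R K <= T) `<=`
      [set` s ++ s'].
    move=> _ [K [iota [<- dimK discK]]] /=; rewrite mem_cat.
    have [exc|nexc] :=
      ltP (abs_discriminant R K `^ gamma) (min_generator_height R K).
      have : Exc (range iota) by exists K, iota.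
      by rewrite ExcE /= => ->.
    apply/orP; right; have : min_generator_height R K <= T `^ gamma.
      by rewrite (le_trans nexc) // ge0_ler_powR ?nnegrE ?(ltW gamma0) //
        ?normr_ge0 // ltW.
    move=> minK.
    have inf_H :
        has_inf [set height R x | x in [set x : K | (<<1; x>> = {:K})%VS]].
      split; first by have [x xP] := exists_generator K; exists (height R x), x.
      by exists 0 => _ [x _ <-]; exact: height_ge0.
    have [_ [x x_gen <-] Hx] := inf_adherent (powR_gt0 gamma Tgt0) inf_H.
    have [f [size_f fx f_le]] := coef_minpoly_le_height R x_gen.
    apply: (s'P K iota x f) => //; first by rewrite size_f dimK.
    move=> i; rewrite /B truncn_ge_nat ?(le_trans ler01) //.
    rewrite natr_absz (le_trans (f_le i)) // dimK -exprMn /r.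
    rewrite lerXn2r ?nnegrE ?mulr_ge0 ?height_ge0 ?powR_ge0 //.
    by move: Hx minK; rewrite /min_generator_height; lra.
  rewrite size_cat size_s' -(ler_nat R) => /le_trans; apply.
  rewrite /C mulrDl natrD lerD //.
    by rewrite ler_peMr // Te // /e !mulr_ge0 ?(ltW gamma0) //; lra.
  rewrite natrM -mulrA ler_wpM2l // natrX.
  have -> : (3 * 4 ^+ D) ^+ D.+1 * T `^ e = (3 * r) ^+ D.+1.
    rewrite /r [(4 * _) ^+ D]exprMn mulrA [RHS]exprMn; congr (_ * _).
    rewrite -!powR_mulrn ?powR_ge0 // -!powRrM; congr (_ `^ _).
    by rewrite /e -natr1 mulrA.
  have Br : B%:R <= r by rewrite truncn_le // (le_trans ler01).
  apply: lerXn2r; rewrite ?nnegrE //;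
    first by rewrite mulr_ge0 // (le_trans ler01).
  by rewrite -addn1 natrD natrM; lra.
(* c T ^ nu <= C T ^ e for all large T is absurd, since e < nu *)
pose d := nu - e; have d0 : 0 < d by rewrite subr_gt0.
pose M := C / c + 1; have M1 : 1 <= M by rewrite lerDr divr_ge0 // ltW.
pose T := Num.max (Num.max 1 (T0 + 1)) (M `^ d^-1).
have T1 : 1 <= T by rewrite !le_max lexx.
have T0T : T0 < T by rewrite !lt_max ltrDl ltr01 orbT.
have MT : M <= T `^ d.
  have {1}-> : M = (M `^ d^-1) `^ d.
    by rewrite -powRrM mulVf ?lt0r_neq0 // powRr1 // (le_trans ler01).
  rewrite ge0_ler_powR ?nnegrE ?powR_ge0 ?(ltW d0) ?(le_trans ler01) //.
  by rewrite le_max lexx orbT.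
have := bound T T1 T0T.
have -> : nu = d + e by rewrite /d subrK.
rewrite powRD; last by rewrite (gt_eqF (lt_le_trans ltr01 T1)) implybT.
rewrite mulrA ler_pM2r ?powR_gt0 ?(lt_le_trans ltr01) // => cT.
have : c * M <= C by rewrite (le_trans _ cT) // ler_wpM2l // ltW.
by rewrite /M mulrDr mulr1 mulrCA divff ?lt0r_neq0 // mulr1; lra.
Qed.
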